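(* Consider the distributed composite problem, with graph, edge weights, functions and constants as in the context: $\mathcal{G}=(\mathcal{V},\mathcal{E})$ is undirected and connected, $l,r\in\mathbb{R}^{|\mathcal{E}|}$ are element-wise positive, $X_0\subseteq\mathbb{R}^n$ is closed and convex, $\psi_0:X_0\to\mathbb{R}$ is proper, closed, continuously differentiable and $1$-strongly convex, each $f_i:X_0\to\mathbb{R}$ ($i\in\mathcal{V}$) is continuously differentiable, convex and $\beta$-smooth, each $g_i:X_0\to\mathbb{R}$ ($i\in\mathcal{V}$) is closed, convex and proper, and $(x^\star,u^\star)\in\mathbb{R}^{|\mathcal{V}|n}\times\mathbb{R}^{|\mathcal{E}|n}$ satisfies $$E_l(\mathcal{G})^\top x^\star=0,\qquad x^\star\in X,\qquad -E_l(\mathcal{G})u^\star-\nabla f(x^\star)\in N_X(x^\star)+\partial g(x^\star).$$ Let $x^1\in X$, $u^1\in\mathbb{R}^{|\mathcal{E}|n}$ be deterministic, and let the sequences $(x^k)_{k\ge1},(u^k)_{k\ge1}$ be generated, for $k=1,2,\ldots$, by $$w^k=L_r(\mathcal{G})x^k+E_l(\mathcal{G})u^k+\nabla f(x^k)+\eta^k,$$ $$x^{k+1}=\operatorname{argmin}_{x\in X}\ \alpha^k\langle w^k,x\rangle+\alpha^kg(x)+B_\psi(x,x^k),$$ $$u^{k+1}=u^k+\alpha^kE_l(\mathcal{G})^\top x^{k+1}.$$ Then the following hold for every integer $K\ge1$. (i) (Noiseless gradient.) If $\eta^k=0$ for all $k$ and $\alpha^k=\alpha$ for all $k$ with $0<\alpha\le\min\{\frac1{\beta+\lambda},\frac1\gamma\}$,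 then, with $\overline{x}^K=\frac1K\sum_{k=1}^Kx^{k+1}$, $$\big(\ell(\overline{x}^K,u^\star)+g(\overline{x}^K)\big)-\big(\ell(x^\star,u^\star)+g(x^\star)\big)\le\frac{V(x^1,u^1)}{\alpha K}.$$ (ii) (Noisy gradient.) If the (deterministic) step sizes satisfy $0<\alpha^k\le\min\{\frac1{2(\beta+\lambda)},\frac1\gamma\}$ for all $k$, and $\eta^1,\eta^2,\ldots$ are mutually independent random vectors in $\mathbb{R}^{|\mathcal{V}|n}$ with $\mathbb{E}[\eta^k]=0$ and $\mathbb{E}\big[\|\eta^k\|_2^2\big]\le\sigma^2$ for all $k$, then, with $\overline{x}^K=\big(\sum_{k=1}^K\alpha^k\big)^{-1}\sum_{k=1}^K\alpha^kx^{k+1}$, $$\mathbb{E}\big[\ell(\overline{x}^K,u^\star)+g(\overline{x}^K)\big]-\big(\ell(x^\star,u^\star)+g(x^\star)\big)\le\frac{V(x^1,u^1)+\sigma^2\sum_{k=1}^K(\alpha^k)^2}{\sum_{k=1}^K\alpha^k}.$$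
   Context: Superscripts $k$ on $\alpha^k$ are indices; $(\alpha^k)^2$ is the square of $\alpha^k$. $\mathcal{G}=(\mathcal{V},\mathcal{E})$ is an undirected graph with at least one edge (an edge is a pair of distinct nodes). Fix an arbitrary orientation of its edges; the incidence matrix $E(\mathcal{G})\in\mathbb{R}^{|\mathcal{V}|\times|\mathcal{E}|}$ has, in the column indexed by an edge, entry $1$ in the row of its head, $-1$ in the row of its tail, and $0$ elsewhere. For element-wise positive $l,r\in\mathbb{R}^{|\mathcal{E}|}$, let $$E_l(\mathcal{G})=(E(\mathcal{G})\,\mathrm{diag}(\sqrt l))\otimes I_n,\qquad L_r(\mathcal{G})=(E(\mathcal{G})\,\mathrm{diag}(r)\,E(\mathcal{G})^\top)\otimes I_n,$$ where $\sqrt l$ is the element-wise square root, $\mathrm{diag}(\cdot)$ is the diagonal matrix with the given diagonal, and $\otimes$ is the Kronecker product. Let $\frac1\gamma=\max\{\alpha\in\mathbb{R}:\alpha l\le r \text{ element-wise}\}$, and let $\lambda$ be the largest eigenvalue of $L_r(\mathcal{G})$. $X=X_0^{|\mathcal{V}|}$ is the Cartesian product of $|\mathcal{V}|$ copies of $X_0$; for $x=[x_1^\top,\ldots,x_{|\mathcal{V}|}^\top]^\top\in X$ (each $x_i\in X_0$), $f(x)=\sum_{i\in\mathcal{V}}f_i(x_i)$, $g(x)=\sum_{i\in\mathcal{V}}g_i(x_i)$ and $\psi(x)=\sum_{i\in\mathcal{V}}\psi_0(x_i)$. The underlying problem is to minimize $f(x)+g(x)$ subject to $E_l(\mathcal{G})^\top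 x=0$, $x\in X$. The functions $g_i$ may be non-smooth. $\psi_0$ is $1$-strongly convex if $\psi_0-\frac12\|\cdot\|_2^2$ is convex over $X_0$; $f_i$ is $\beta$-smooth (constant $\beta\ge0$) if $\frac\beta2\|\cdot\|_2^2-f_i$ is convex over $X_0$. The normal cone of $X$ at $x\in X$ is $N_X(x)=\{u:\langle u,x'-x\rangle\le0\ \forall x'\in X\}$. The subdifferential of $g:X\to\mathbb{R}$ at $x\in X$ is $\partial g(x)=\{u: g(x')-g(x)\ge\langle u,x'-x\rangle\ \forall x'\in X\}$. The Bregman divergence is $B_\psi(x',x)=\psi(x')-\psi(x)-\langle\nabla\psi(x),x'-x\rangle$. Lagrangian of the smooth part: $\ell(x,u)=f(x)+\langle E_l(\mathcal{G})u,x\rangle$. Energy function: $V(x,u)=B_\psi(x^\star,x)+\frac12\|u-u^\star\|_2^2$. *)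

(* Defs.v *)
(* MathComp-Analysis; the Kronecker product [*t] is in mxtens (real-closed). *)
From mathcomp Require Import all_boot all_order all_algebra finmap.
From mathcomp Require Import all_classical all_reals all_analysis.
From mathcomp Require Export mxtens.
Set Implicit Arguments.
Unset Strict Implicit.
Unset Printing Implicit Defensive.
Import Order.TTheory GRing.Theory Num.Theory.
Import numFieldNormedType.Exports.

Local Open Scope classical_set_scope.
Local Open Scope ring_scope.

Record graph (N : nat) := Graph {
  edges : {set {set 'I_N}} ;
  edges_card2 : forall e, e \in edges -> #|e| = 2%N }.

Definition nb_edges N (G : graph N) : nat := #|edges G|.

Definition adj N (G : graph N) : rel 'I_N :=
  fun i j => [set i; j]%SET \in edges G.

Definition connected_graph N (G : graph N) : Prop :=
  forall i j, connect (adj G) i j.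

(* Columns of edge-indexed matrices are numbered by [enum_val]. *)
Record orientation N (G : graph N) := Orientation {
  head : 'I_(nb_edges G) -> 'I_N ;
  tail : 'I_(nb_edges G) -> 'I_N ;
  head_tail : forall e, enum_val e = [set head e; tail e]%SET }.

Section Matrices.
Context {R : realType} {N : nat} {G : graph N}.

Definition incidence (o : orientation G) : 'M[R]_(N, nb_edges G) :=
  \matrix_(i, e) if i == head o e then 1 else if i == tail o e then -1 else 0.

Definition El (o : orientation G) (l : 'rV[R]_(nb_edges G)) (n : nat) :
    'M[R]_(N * n, nb_edges G * n) :=
  (incidence o *m diag_mx (map_mx Num.sqrt l)) *t (1%:M : 'M[R]_n).

Definition Lr (o : orientation G) (r : 'rV[R]_(nb_edges G)) (n : nat) :
    'M[R]_(N * n) :=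
  (incidence o *m diag_mx r *m (incidence o)^T) *t (1%:M : 'M[R]_n).

End Matrices.

Section Euclidean.
Context {R : realType}.

Definition is_max (A : set R) (m : R) : Prop := A m /\ ubound A m.

(* The norm of the library on matrices is the sup norm (which induces the
   topology used below), hence the separate Euclidean norm. *)
Definition dot p (u v : 'cV[R]_p) : R := \sum_i u i 0 * v i 0.

Definition norm2 p (v : 'cV[R]_p) : R := Num.sqrt (dot v v).

Context {p : nat}.
Implicit Types (D : set 'cV[R]_p) (h : 'cV[R]_p -> R) (x y : 'cV[R]_p).

(* Real functions on a subset D are represented by total functions whose values
   outside D are never used. *)

(* [dh] is a continuous gradient of [h : D -> R]; the first-order expansion is
   relative to D, so that points of D that are not interior are allowed.  When D
   has empty interior, [dh] is one choice among the possible gradients. *)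
Definition C1_on D h (dh : 'cV[R]_p -> 'cV[R]_p) : Prop :=
  (forall x, D x -> forall e : R, 0 < e ->
     \forall y \near within D (nbhs x),
       `|h y - h x - dot (dh x) (y - x)| <= e * norm2 (y - x)) /\
  {within D, continuous dh}.

(* A real-valued function never takes the values +oo and -oo on D, so it is
   proper exactly when D is nonempty. *)
Definition proper_on D h : Prop := D !=set0.

Definition closed_on D h : Prop :=
  closed [set z : 'cV[R]_p * R | D z.1 /\ h z.1 <= z.2].

Definition strongly_convex1_on D h : Prop :=
  convex_function D (fun x => h x - 2^-1 * norm2 x ^+ 2).

Definition smooth_on D (beta : R) h : Prop :=
  convex_function D (fun x => beta / 2 * norm2 x ^+ 2 - h x).

Definition normal_cone D x : set 'cV[R]_p :=
  [set u | forall y, D y -> dot u (y - x) <= 0].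

Definition subdiff D h x : set 'cV[R]_p :=
  [set u | forall y, D y -> h y - h x >= dot u (y - x)].

Definition bregman h (dh : 'cV[R]_p -> 'cV[R]_p) y x : R :=
  h y - h x - dot (dh x) (y - x).

Definition is_argmin D h x : Prop := D x /\ forall y, D y -> h x <= h y.

(* Sequences indexed by 1, 2, ...: the values at index 0 are irrelevant. *)
Definition iterates q (X : set 'cV[R]_p) (L : 'M[R]_p) (E : 'M[R]_(p, q))
    (df : 'cV[R]_p -> 'cV[R]_p) (g : 'cV[R]_p -> R)
    (psi : 'cV[R]_p -> R) (dpsi : 'cV[R]_p -> 'cV[R]_p)
    (alpha : nat -> R) (eta : nat -> 'cV[R]_p)
    (x1 : 'cV[R]_p) (u1 : 'cV[R]_q)
    (x : nat -> 'cV[R]_p) (u : nat -> 'cV[R]_q) : Prop :=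
  [/\ x 1%N = x1, u 1%N = u1 &
    forall k, (1 <= k)%N ->
      let w := L *m x k + E *m u k + df (x k) + eta k in
      is_argmin X (fun y => alpha k * dot w y + alpha k * g y
                            + bregman psi dpsi y (x k)) (x k.+1) /\
      u k.+1 = u k + alpha k *: (E^T *m x k.+1)].

Definition lagrangian q (f : 'cV[R]_p -> R) (E : 'M[R]_(p, q))
    (x : 'cV[R]_p) (u : 'cV[R]_q) : R :=
  f x + dot (E *m u) x.

Definition energy q (psi : 'cV[R]_p -> R) (dpsi : 'cV[R]_p -> 'cV[R]_p)
    (xs : 'cV[R]_p) (us : 'cV[R]_q) (x : 'cV[R]_p) (u : 'cV[R]_q) : R :=
  bregman psi dpsi xs x + 2^-1 * norm2 (u - us) ^+ 2.

End Euclidean.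

Section Blocks.
Context {R : realType} {N n : nat}.

(* [mxtens_index (i, j)] is i * n + j, the index convention of [*t]. *)
Definition block (x : 'cV[R]_(N * n)) (i : 'I_N) : 'cV[R]_n :=
  \col_j x (mxtens_index (i, j)) 0.

Definition stack (y : 'I_N -> 'cV[R]_n) : 'cV[R]_(N * n) :=
  \col_k y (mxtens_unindex k).1 (mxtens_unindex k).2 0.

Definition prod_set (X0 : set 'cV[R]_n) : set 'cV[R]_(N * n) :=
  [set x | forall i, X0 (block x i)].

Definition sep_sum (h : 'I_N -> 'cV[R]_n -> R) (x : 'cV[R]_(N * n)) : R :=
  \sum_i h i (block x i).

Definition sep_grad (dh : 'I_N -> 'cV[R]_n -> 'cV[R]_n) (x : 'cV[R]_(N * n)) :
    'cV[R]_(N * n) :=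
  stack (fun i => dh i (block x i)).

End Blocks.

Section Probability.
Context {R : realType} {d : measure_display} {T : measurableType d}.
Context {p : nat}.

Definition borel_set : set (set 'cV[R]_p) := <<s open >>.

Definition random_vector (Y : T -> 'cV[R]_p) : Prop :=
  forall B, borel_set B -> measurable (Y @^-1` B).

Definition mutually_independent (P : probability T R) (I : choiceType)
    (A : set I) (Y : I -> T -> 'cV[R]_p) : Prop :=
  forall (J : {fset I}) (B : I -> set 'cV[R]_p),
    [set` J] `<=` A -> (forall i, i \in J -> borel_set (B i)) ->
    P (\bigcap_(i in [set` J]) (Y i @^-1` B i)) =
      (\prod_(i <- J) P (Y i @^-1` B i))%E.

End Probability.

(* Main.v *)
(* The energy [V] descends along the iterates: testing the optimality condition
   of the argmin at [xs] and using the three-point identity for the Bregman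
   divergence, convexity and smoothness of [f], and
   [alpha * |E^T x|^2 <= <L x, x> <= lambda * |x|^2], one step satisfies
   [alpha (H x' - H xs) <= V - V' - (1 - alpha (beta + lambda)) / 2 |x' - x|^2
    - alpha <eta, x' - xs>] with [H = ell(., us) + g].  Telescoping and Jensen's
   inequality give (i).

   For (ii), [- alpha <eta, x' - x>] is absorbed by Young's inequality, at the
   price of [alpha^2 |eta|^2], and there remains [<eta^k, x^k - xs>], which has
   mean zero because [x^k] only depends on [eta^1, ..., eta^(k-1)].  To make
   this precise without product measures: the argmin is a nonexpansive function
   of the linear term, so [x^k] depends continuously on the previous noises, and
   a continuous function of the noises is a dominated limit of functions of
   finitely many comparisons of their coordinates with rationals; independence
   applies directly to the events defined by such comparisons.  The same
   approximation yields the measurability of the iterates, and that of the gap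
   because [g] is lower semicontinuous. *)
Require Import Defs.
From mathcomp Require Import all_boot all_order all_algebra finmap.
From mathcomp Require Import all_classical all_reals all_analysis measurable_realfun.
From mathcomp Require Import ring lra.
Import Order.TTheory GRing.Theory Num.Theory.
Import numFieldNormedType.Exports.

Set Implicit Arguments.
Unset Strict Implicit.
Unset Printing Implicit Defensive.

Local Open Scope classical_set_scope.
Local Open Scope ring_scope.

(** * Euclidean geometry and the Rayleigh quotient *)

Section DotProduct.
Context {R : realType} {p : nat}.
Implicit Types (u v w : 'cV[R]_p) (a : R).

Lemma dotC u v : dot u v = dot v u.
Proof. by apply: eq_bigr => i _; rewrite mulrC. Qed.

Lemma dotDl u v w : dot (u + v) w = dot u w + dot v w.
Proof. by rewrite /dot -big_split; apply: eq_bigr => i _; rewrite mxE mulrDl. Qed.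

Lemma dotZl a u v : dot (a *: u) v = a * dot u v.
Proof. by rewrite /dot mulr_sumr; apply: eq_bigr => i _; rewrite mxE mulrA. Qed.

Lemma dotNl u v : dot (- u) v = - dot u v.
Proof. by rewrite -scaleN1r dotZl mulN1r. Qed.

Lemma dotBl u v w : dot (u - v) w = dot u w - dot v w.
Proof. by rewrite dotDl dotNl. Qed.

Lemma dotDr u v w : dot u (v + w) = dot u v + dot u w.
Proof. by rewrite dotC dotDl !(dotC u). Qed.

Lemma dotZr a u v : dot u (a *: v) = a * dot u v.
Proof. by rewrite dotC dotZl dotC. Qed.

Lemma dotNr u v : dot u (- v) = - dot u v.
Proof. by rewrite dotC dotNl dotC. Qed.

Lemma dotBr u v w : dot u (v - w) = dot u v - dot u w.
Proof. by rewrite dotDr dotNr. Qed.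

Lemma dot0l u : dot 0 u = 0.
Proof. by rewrite -(scale0r 0) dotZl mul0r. Qed.

Lemma dot0r u : dot u 0 = 0.
Proof. by rewrite dotC dot0l. Qed.

Lemma dot_ge0 u : 0 <= dot u u.
Proof. by apply: sumr_ge0 => i _; rewrite -expr2 sqr_ge0. Qed.

Lemma sqr_coord_le_dot u i : u i 0 ^+ 2 <= dot u u.
Proof.
rewrite /dot (bigD1 i)//= -expr2 lerDl.
by apply: sumr_ge0 => j _; rewrite -expr2 sqr_ge0.
Qed.

Lemma dot_eq0 u : dot u u = 0 -> u = 0.
Proof.
move=> u0; apply/colP => i; rewrite mxE; apply/eqP.
by rewrite -sqrf_eq0 eq_le sqr_ge0 -u0 sqr_coord_le_dot.
Qed.

Lemma dot_gt0 u : u != 0 -> 0 < dot u u.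
Proof.
by move=> u0; rewrite lt_neqAle dot_ge0 eq_sym andbT; apply: contra_neq u0 => /dot_eq0.
Qed.

Lemma norm2_sqr u : norm2 u ^+ 2 = dot u u.
Proof. by rewrite sqr_sqrtr// dot_ge0. Qed.

Lemma norm2_ge0 u : 0 <= norm2 u. Proof. exact: sqrtr_ge0. Qed.

Lemma coord_le_norm2 u i : `|u i 0| <= norm2 u.
Proof. by rewrite -sqrtr_sqr ler_wsqrtr// sqr_coord_le_dot. Qed.

Lemma norm2Z a u : norm2 (a *: u) = `|a| * norm2 u.
Proof. by rewrite /norm2 dotZl dotZr mulrA -expr2 sqrtrM ?sqr_ge0// sqrtr_sqr. Qed.

Lemma dot_young u v (e : R) : 0 < e ->
  dot u v <= e * dot u u + dot v v / (4 * e).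
Proof.
move=> e0; rewrite /dot mulr_sumr mulr_suml -big_split ler_sum// => i _ /=.
rewrite -subr_ge0 (_ : _ - _ = (2 * e * u i 0 - v i 0) ^+ 2 / (4 * e)).
  by rewrite divr_ge0 ?sqr_ge0// mulr_ge0// ltW.
by field; rewrite gt_eqF.
Qed.

Lemma cauchy_schwarz u v : dot u v <= norm2 u * norm2 v.
Proof.
have [->|u0] := eqVneq u 0; first by rewrite dot0l mulr_ge0// norm2_ge0.
have [->|v0] := eqVneq v 0; first by rewrite dot0r mulr_ge0// norm2_ge0.
have nu : 0 < norm2 u by rewrite sqrtr_gt0 dot_gt0.
have nv : 0 < norm2 v by rewrite sqrtr_gt0 dot_gt0.
(* This [e] minimizes Young's bound: each of its two terms becomes half of |u| |v|. *)
have e0 : 0 < norm2 v / (2 * norm2 u) by rewrite divr_gt0// mulr_gt0.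
apply: le_trans (dot_young u v e0) _; rewrite -!norm2_sqr le_eqVlt.
by apply/orP; left; apply/eqP; field; rewrite !gt_eqF.
Qed.

End DotProduct.

Lemma dot_mulmx {R : realType} p q (A : 'M[R]_(p, q)) u v :
  dot (A *m u) v = dot u (A^T *m v).
Proof.
rewrite /dot; under eq_bigr do rewrite mxE mulr_suml.
rewrite exchange_big; apply: eq_bigr => j _; rewrite mxE mulr_sumr.
by apply: eq_bigr => i _; rewrite mxE mulrCA mulrA.
Qed.

Lemma cvg_sumr {R : realType} {I : Type} (r : seq I) {T} (F : set_system T)
  {FF : Filter F} (f : I -> T -> R) (a : I -> R) :
  (forall i, f i t @[t --> F] --> a i) ->
  \sum_(i <- r) f i t @[t --> F] --> \sum_(i <- r) a i.
Proof. by move=> fa; apply: cvg_big => //; exact: add_continuous. Qed.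

Section CoordinatewiseConvergence.
Context {R : realType} {p : nat}.

Lemma cvg_coordP {T} (F : set_system T) {FF : Filter F} (f : T -> 'cV[R]_p) (v : 'cV[R]_p) :
  (f @ F --> v) <-> forall i, (fun t => f t i 0) @ F --> v i 0.
Proof.
split=> [fv i|fv].
  exact: (cvg_comp f (fun v : 'cV[R]_p => v i 0) fv (@coord_continuous R p 1 i 0 v)).
apply/cvgrPdist_lt => e e0.
have : forall i, \forall t \near F, `|v i 0 - f t i 0| < e.
  by move=> i; move/cvgrPdist_lt: (fv i); apply.
move=> /filter_forall; apply: filterS => t h.
rewrite /Num.Def.normr/= mx_normrE; apply/bigmax_ltP; split=> // -[i j] _.
by rewrite /= [j]ord1 !mxE h.
Qed.

Lemma cvg_dot {T} (F : set_system T) {FF : Filter F} (f g : T -> 'cV[R]_p) (u v : 'cV[R]_p) :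
  f @ F --> u -> g @ F --> v -> (fun t => dot (f t) (g t)) @ F --> dot u v.
Proof.
move=> /cvg_coordP fu /cvg_coordP gv.
by apply: cvg_sumr => i; apply: cvgM.
Qed.

End CoordinatewiseConvergence.

Lemma cvg_mulmx {R : realType} p q (A : 'M[R]_(p, q)) {T} (F : set_system T)
  {FF : Filter F} (f : T -> 'cV[R]_q) (u : 'cV[R]_q) :
  f @ F --> u -> (fun t => A *m f t) @ F --> A *m u.
Proof.
move=> /cvg_coordP fu; apply/cvg_coordP => i; rewrite mxE.
rewrite (eq_cvg _ _ (fun t => mxE mulmx_key _ i 0)).
by apply: cvg_sumr => j; apply: cvgMl_tmp; exact: fu.
Qed.

Section Rayleigh.
Context {R : realType} {p : nat} (L : 'M[R]_p).
Hypothesis symL : L^T = L.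

Let q (v : 'cV[R]_p) := dot (L *m v) v.

(** Made of row vectors because [bounded_closed_compact] is applied to them; hence the
    transposes. *)
Let sphere := [set v : 'rV[R]_p | dot v^T v^T = 1].

Lemma continuous_quad_tr (M : 'M[R]_p) :
  continuous (fun v : 'rV[R]_p => dot (M *m v^T) v^T).
Proof.
move=> v; have tr : (fun w : 'rV[R]_p => w^T) @ v --> v^T.
  apply/(@cvg_coordP R p _ _ (nbhs_filter v)) => i.
  rewrite mxE (eq_cvg _ _ (fun w => mxE trmx_key _ i 0)).
  exact: (@coord_continuous R 1 p 0 i v).
by apply: (@cvg_dot R p _ _ (nbhs_filter v)) => //;
  apply: (@cvg_mulmx R p p M _ _ (nbhs_filter v)).
Qed.

Lemma compact_sphere : compact sphere.
Proof.
apply: bounded_closed_compact.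
  exists 1; split => // M M1 v sv /=.
  rewrite /Num.Def.normr/= mx_normrE; apply/bigmax_leP; split=> [|[i j] _ /=].
    by rewrite ltW// (lt_trans _ M1).
  rewrite (le_trans _ (ltW M1))// -(ler_pXn2r (n := 2)) ?nnegrE//.
  rewrite expr1n real_normK ?num_real// -sv; have := sqr_coord_le_dot v^T j.
  by rewrite mxE [i]ord1.
(* The identity matrix makes the squared norm an instance of [continuous_quad_tr]. *)
rewrite (_ : sphere = (fun v : 'rV[R]_p => dot (1%:M *m v^T) v^T) @^-1` [set 1]).
  apply: preimage_closed; last exact: closed_eq.
  by move=> v _; exact: continuous_quad_tr.
by apply/seteqP; split=> v /=; rewrite mul1mx.
Qed.

(* A maximizer of [q] on the sphere is an eigenvector for the maximal value. *)
Lemma rayleigh_le (lambda : R) v :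
  ubound [set a : R | eigenvalue L a] lambda ->
  dot (L *m v) v <= lambda * dot v v.
Proof.
move=> ublam.
have [->|v0] := eqVneq v 0; first by rewrite dot0r dot0r mulr0.
have scaled w : w != 0 -> sphere ((norm2 w)^-1 *: w)^T.
  move=> w0; rewrite /sphere/= trmxK dotZl dotZr -norm2_sqr.
  by rewrite mulrA -invfM -expr2 mulVf// sqrf_eq0 gt_eqF// sqrtr_gt0 dot_gt0.
have [c /set_mem sc cmax] :
    exists2 c, c \in sphere & forall t, t \in sphere -> q t^T <= q c^T.
  apply: compact_EVT_max; [by exists ((norm2 v)^-1 *: v)^T; exact: scaled|
    exact: compact_sphere|].
  by apply: continuous_subspaceT; exact: continuous_quad_tr.
set mu := q c^T in cmax.
have le_mu w : q w <= mu * dot w w.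
  have [->|w0] := eqVneq w 0; first by rewrite /q dot0r dot0r mulr0.
  have := cmax _ (mem_set (scaled _ w0)).
  rewrite trmxK {1}/q -scalemxAr dotZl dotZr mulrA -invfM -expr2 norm2_sqr.
  by rewrite mulrC ler_pdivrMr ?dot_gt0.
have [d dE] : exists d, d = mu *: c^T - L *m c^T by eexists.
have d0 : d = 0.
  apply: dot_eq0; apply/eqP; rewrite eq_le dot_ge0 andbT leNgt; apply/negP => dgt.
  (* If the residual [d] were nonzero, moving from [c] by [s d] with [s = - |d|^2 / (Q + 1)] would
     change [mu |w|^2 - q w] from 0 to [s (2 |d|^2 + s Q)], which is negative. Adding 1 keeps the
     denominator positive even when [Q = 0]. *)
  pose Q := mu * dot d d - q d.
  have Q0 : 0 <= Q by rewrite subr_ge0.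
  have := le_mu (c^T + (- (dot d d / (Q + 1))) *: d).
  have Ldc : dot (L *m d) c^T = dot (L *m c^T) d by rewrite dot_mulmx symL dotC.
  have ddE : dot d d = mu * dot c^T d - dot (L *m c^T) d by rewrite {1}dE dotBl dotZl.
  rewrite /q mulmxDr -scalemxAr !(dotDl, dotDr, dotZl, dotZr) Ldc (dotC d c^T).
  rewrite -/(q c^T) -/mu -/(q d) sc.
  set s := - _; set a := dot (L *m _) _; set b := dot c^T d in ddE *.
  rewrite -subr_ge0 (_ : _ - _ = s * (2 * dot d d + s * Q)); last first.
    by rewrite /Q ddE -/a; ring.
  rewrite leNgt => /negP; apply.
  have Q1 : 0 < Q + 1 by rewrite ltr_wpDl.
  rewrite nmulr_rlt0 ?oppr_lt0 ?divr_gt0//.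
  rewrite (_ : _ + _ = dot d d * (Q + 2) / (Q + 1)); last first.
    by rewrite /s; field; rewrite gt_eqF.
  by rewrite divr_gt0// mulr_gt0// ltr_wpDl.
have /ublam mulam : eigenvalue L mu.
  apply/eigenvalueP; exists c.
    apply: trmx_inj; rewrite trmx_mul symL linearZ/=; apply/esym/eqP.
    by rewrite -subr_eq0 -dE d0.
  by apply/eqP => c0; move: sc; rewrite /sphere/= c0 trmx0 dot0r => /esym/eqP; rewrite oner_eq0.
by rewrite (le_trans (le_mu v))// ler_wpM2r// dot_ge0.
Qed.

End Rayleigh.

(** * Gradients relative to a convex set *)

Section RelativeGradient.
Context {R : realType} {p : nat}.
Implicit Types (D : set 'cV[R]_p) (h : 'cV[R]_p -> R) (dh : 'cV[R]_p -> 'cV[R]_p).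

Lemma convE (E : lmodType R) (t : {i01 R}) (x y : convex_lmodType E) :
  conv t x y = (y : E) + t%:num *: ((x : E) - y).
Proof.
rewrite [LHS](_ : _ = t%:num *: (x : E) + (1 - t%:num) *: (y : E))//.
by rewrite scalerBl scale1r scalerBr addrCA.
Qed.

Lemma conv_realE (t : {i01 R}) (a b : R^o) : conv t a b = b + t%:num * (a - b).
Proof. exact: (@convE R^o). Qed.

Lemma convex_set_segment D x y (t : R) : convex_set D -> D x -> D y ->
  0 <= t <= 1 -> D (x + t *: (y - x)).
Proof.
move=> cD Dx Dy /andP[t0 t1].
by have := cD y x (Itv01 t0 t1) (mem_set Dy) (mem_set Dx); rewrite convE => /set_mem.
Qed.

Lemma convex_function_segment D h x y (t : R) : convex_function D h ->
  D x -> D y -> 0 <= t <= 1 -> h (x + t *: (y - x)) <= h x + t * (h y - h x).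
Proof.
move=> cD Dx Dy /andP[t0 t1].
have := cD (Itv01 t0 t1) y x (mem_set Dy) (mem_set Dx).
by rewrite convE conv_realE.
Qed.

Lemma convex_functionD D h1 h2 : convex_function D h1 -> convex_function D h2 ->
  convex_function D (fun x => h1 x + h2 x).
Proof.
move=> c1 c2 t x y Dx Dy; apply: le_trans (lerD (c1 t x y Dx Dy) (c2 t x y Dx Dy)) _.
by rewrite !conv_realE le_eqVlt; apply/orP; left; apply/eqP; ring.
Qed.

Lemma convex_function_dot D w : convex_function D (dot w).
Proof.
move=> t x y _ _; rewrite convE conv_realE dotDr dotZr dotBr.
exact: lexx.
Qed.

(** Weaker than [C1_on]: the expansion is asked along segments of [D] only. This suffices for the
    convexity arguments and passes easily to block sums. *)
Definition directional D h dh := forall x y (e : R), D x -> D y -> 0 < e ->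
  \forall t \near 0^'+,
    `|h (x + t *: (y - x)) - h x - t * dot (dh x) (y - x)| <= e * t.

Lemma C1_directional D h dh : convex_set D -> C1_on D h dh -> directional D h dh.
Proof.
move=> cD [dhD _] x y e Dx Dy e0.
(* The Euclidean norm scales the error bound and, in [m0], the sup norm scales the radius of the
   ball; adding 1 covers [y = x]. *)
have n0 : 0 < norm2 (y - x) + 1 by rewrite ltr_wpDl// norm2_ge0.
have /= := dhD x Dx _ (divr_gt0 e0 n0).
rewrite near_withinE => /nbhs_ballP[d /= d0 hd].
have m0 : 0 < `|y - x| + 1 by rewrite ltr_wpDl.
near=> t.
have t0 : 0 < t by [].
have t1 : t <= 1 by near: t; apply: nbhs_right_le.
have td : t < d / (`|y - x| + 1).
  by near: t; apply: nbhs_right_lt; rewrite divr_gt0.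
have := hd (x + t *: (y - x)).
have -> : x + t *: (y - x) - x = t *: (y - x) by rewrite addrAC subrr add0r.
rewrite dotZr norm2Z (gtr0_norm t0) => /(_ _ _)/le_trans; apply.
- rewrite -ball_normE /ball_/= opprD addrA subrr add0r normrN normrZ (gtr0_norm t0).
  move: td; rewrite ltr_pdivlMr//; apply: le_lt_trans.
  by rewrite ler_wpM2l ?lerDl// ltW.
- by apply: convex_set_segment => //; rewrite ltW.
- rewrite -mulrA ler_pM2l// mulrCA ler_piMr ?(ltW t0)//.
  by rewrite mulrC ler_pdivrMr// mul1r lerDl.
Unshelve. all: end_near. Qed.

(** Apply convexity on the segment to [h - c |.|^2], divide by [t] and let [t] tend to 0. The sign
    of [c] is free: positive for strong convexity, zero for convexity, negative for smoothness
    through [- h]. *)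
Lemma convex_tangent D h dh (c : R) x y : convex_set D -> directional D h dh ->
  convex_function D (fun z => h z - c * norm2 z ^+ 2) -> D x -> D y ->
  c * dot (y - x) (y - x) <= h y - h x - dot (dh x) (y - x).
Proof.
move=> cD dhD ch Dx Dy; apply/ler_addgt0Pr => e e0.
have e20 : 0 < e / 2 by rewrite divr_gt0.
have dir := dhD x y _ Dx Dy e20.
have cvx t := @convex_function_segment _ _ x y t ch Dx Dy.
have [z zE] : exists z, z = y - x by eexists.
have yE : y = x + z by rewrite zE addrC subrK.
rewrite -!zE in dir *.
have S0 := dot_ge0 z; set S := dot z z in S0 *.
have m0 : 0 < `|c| * S + 1 by rewrite ltr_wpDl// mulr_ge0.
(* After division by [t], the expansion error and the leftover [t c |z|^2] each cost at most
   [e / 2]. *)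
suff [t [t0 t1 tS tdir]] : exists t : R,
    [/\ 0 < t, t <= 1, t * (`|c| * S + 1) <= e / 2 &
    `|h (x + t *: z) - h x - t * dot (dh x) z| <= e / 2 * t].
  have := cvx t; rewrite -zE (ltW t0) t1 => /(_ isT).
  rewrite !norm2_sqr.
  have -> : dot y y = dot x x + 2 * dot x z + S.
    by rewrite yE !(dotDl, dotDr) (dotC z x) -/S; ring.
  rewrite !(dotDl, dotDr, dotZl, dotZr) -/S (dotC z x).
  move: tdir; rewrite ler_norml => /andP[+ _].
  have tcS : t * (c * S) <= e / 2.
    apply: le_trans tS; rewrite ler_pM2l// (@le_trans _ _ (`|c| * S))//; last first.
      by rewrite lerDl.
    by rewrite ler_wpM2r// ler_norm.
  rewrite -[_ <= _ + e]subr_ge0 -(pmulr_rge0 _ t0).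
  have := ler_wpM2l (ltW t0) tcS.
  lra.
near (0 : R)^'+ => t.
exists t; split => //.
- by near: t; apply: nbhs_right_le.
- by rewrite -ler_pdivlMr//; near: t; apply: nbhs_right_le; rewrite !divr_gt0.
- by near: t.
Unshelve. all: end_near. Qed.

End RelativeGradient.

(** * Block-separable functions on the product set *)

Section Blockwise.
Context {R : realType} {N n : nat}.
Implicit Types (x y : 'cV[R]_(N * n)) (X : set 'cV[R]_n).

Lemma blockD x y i : block (x + y) i = block x i + block y i.
Proof. by apply/colP => j; rewrite !mxE. Qed.

Lemma blockZ (a : R) x i : block (a *: x) i = a *: block x i.
Proof. by apply/colP => j; rewrite !mxE. Qed.

Lemma blockB x y i : block (x - y) i = block x i - block y i.
Proof. by rewrite blockD -scaleN1r blockZ scaleN1r. Qed.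

Lemma block_stack (y : 'I_N -> 'cV[R]_n) i : block (stack y) i = y i.
Proof. by apply/colP => j; rewrite !mxE mxtens_indexK. Qed.

Lemma dot_block x y : dot x y = \sum_i dot (block x i) (block y i).
Proof.
rewrite /dot (reindex (@mxtens_index N n)); last first.
  exists (@mxtens_unindex N n) => k _; [exact: mxtens_indexK|exact: mxtens_unindexK].
rewrite (eq_bigr (fun ij : 'I_N * 'I_n =>
    x (mxtens_index (ij.1, ij.2)) 0 * y (mxtens_index (ij.1, ij.2)) 0)); last by case.
rewrite -(pair_bigA _ (fun i j => x (mxtens_index (i, j)) 0 * y (mxtens_index (i, j)) 0)).
by apply: eq_bigr => i _; apply: eq_bigr => j _; rewrite !mxE.
Qed.

Lemma dot_sep_grad (dh : 'I_N -> 'cV[R]_n -> 'cV[R]_n) x y :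
  dot (sep_grad dh x) y = \sum_i dot (dh i (block x i)) (block y i).
Proof. by rewrite dot_block; apply: eq_bigr => i _; rewrite block_stack. Qed.

Lemma block_conv (t : {i01 R}) (x y : convex_lmodType 'cV[R]_(N * n)) i :
  block (conv t x y) i =
  conv t (block x i : convex_lmodType 'cV[R]_n) (block y i : convex_lmodType 'cV[R]_n).
Proof. by rewrite !convE blockD blockZ blockB. Qed.

Lemma convex_prod_set X : convex_set X -> convex_set (@prod_set R N n X).
Proof.
move=> cX x y t /set_mem Dx /set_mem Dy; apply/mem_set => i.
by rewrite block_conv; apply/set_mem/cX; apply/mem_set.
Qed.

Lemma convex_sep_sum X (h : 'I_N -> 'cV[R]_n -> R) :
  (forall i, convex_function X (h i)) -> convex_function (prod_set X) (sep_sum h).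
Proof.
move=> ch t x y /set_mem Dx /set_mem Dy.
rewrite conv_realE /sep_sum -sumrB mulr_sumr -big_split/=; apply: ler_sum => i _.
by rewrite block_conv -conv_realE; apply: ch; apply/mem_set.
Qed.

Lemma directional_sep_sum X (h : 'I_N -> 'cV[R]_n -> R) dh :
  (forall i, directional X (h i) (dh i)) ->
  directional (prod_set X) (sep_sum h) (sep_grad dh).
Proof.
move=> hd x y e Dx Dy e0.
(* Each of the [N] blocks gets an equal share of the tolerance; [N.+1] keeps the share meaningful
   when [N = 0]. *)
have eN : 0 < e / N.+1%:R by rewrite divr_gt0.
have hnear : \forall t \near 0^'+, forall i,
    `|h i (block x i + t *: (block y i - block x i)) - h i (block x i)
      - t * dot (dh i (block x i)) (block y i - block x i)| <= e / N.+1%:R * t.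
  by apply: filter_forall => i; apply: hd.
near=> t.
have t0 : 0 < t by [].
have ht : forall i,
    `|h i (block x i + t *: (block y i - block x i)) - h i (block x i)
      - t * dot (dh i (block x i)) (block y i - block x i)| <= e / N.+1%:R * t.
  by near: t.
rewrite dot_sep_grad mulr_sumr /sep_sum -!sumrB.
apply: le_trans (ler_norm_sum _ _ _) _.
apply: (@le_trans _ _ (\sum_(i < N) e / N.+1%:R * t)).
  by apply: ler_sum => i _; rewrite blockD blockZ blockB; exact: ht.
rewrite sumr_const card_ord -[_ *+ N]mulr_natl mulrA ler_pM2r// mulrCA ler_piMr ?(ltW e0)//.
by rewrite ler_pdivrMr// mul1r ler_nat.
Unshelve. all: end_near. Qed.

Lemma bregman_sep_sum (h : 'I_N -> 'cV[R]_n -> R) dh x y :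
  bregman (sep_sum h) (sep_grad dh) y x =
  \sum_i bregman (h i) (dh i) (block y i) (block x i).
Proof.
rewrite /bregman dot_sep_grad -!sumrB; apply: eq_bigr => i _.
by rewrite blockB.
Qed.

Lemma sep_sum_tangent X (h : 'I_N -> 'cV[R]_n -> R) dh (c : R) x y :
  convex_set X -> (forall i, directional X (h i) (dh i)) ->
  (forall i, convex_function X (fun z => h i z - c * norm2 z ^+ 2)) ->
  prod_set X x -> prod_set X y ->
  c * dot (y - x) (y - x) <= bregman (sep_sum h) (sep_grad dh) y x.
Proof.
move=> cX dh_h ch Dx Dy; rewrite bregman_sep_sum dot_block mulr_sumr.
by apply: ler_sum => i _; rewrite blockB; apply: (convex_tangent cX).
Qed.

End Blockwise.

(** * Weighted incidence matrices and Laplacians *)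

Section IncidenceMatrices.
Context {R : realType} {N : nat} {G : graph N} (o : orientation G) (n : nat).
Implicit Types (l r : 'rV[R]_(nb_edges G)) (v : 'cV[R]_(N * n)).

(** Here the incidence matrix is weighted by [r] itself, so that each [sqrt (r e)] occurs twice and
    the product restores [r e]. *)
Lemma LrE r : (forall e, 0 <= r 0 e) -> Lr o r n = El o r n *m (El o r n)^T.
Proof.
move=> r0; rewrite /Lr /El trmx_tens tensmx_mul trmx1 mulmx1; congr (_ *t _).
rewrite trmx_mul tr_diag_mx mulmxA -[in RHS](mulmxA (incidence o)); congr (_ *m _ *m _).
rewrite mulmx_diag; congr diag_mx; apply/rowP => e.
by rewrite !mxE -expr2 sqr_sqrtr.
Qed.

(** A weight only scales the rows of its edge in [E^T], the edge being the first component of the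
    unindexed row number. This is what links [E_l] to [L_r], for kernels and for norms. *)
Lemma tr_El_rescale l r (v : 'cV[R]_(N * n)) k : (forall e, 0 < l 0 e) ->
  ((El o r n)^T *m v) k 0 =
  Num.sqrt (r 0 (mxtens_unindex k).1) / Num.sqrt (l 0 (mxtens_unindex k).1) *
  ((El o l n)^T *m v) k 0.
Proof.
move=> l0; rewrite !mxE mulr_sumr; apply: eq_bigr => i _.
rewrite mulrA; congr (_ * _).
rewrite /El !mul_mx_diag /tensmx !mxE.
by field; rewrite gt_eqF// sqrtr_gt0.
Qed.

Lemma Lr_sym r : (Lr o r n)^T = Lr o r n.
Proof.
by rewrite /Lr trmx_tens trmx1 !trmx_mul trmxK tr_diag_mx mulmxA.
Qed.

Lemma dot_Lr r v : (forall e, 0 <= r 0 e) ->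
  dot (Lr o r n *m v) v = dot ((El o r n)^T *m v) ((El o r n)^T *m v).
Proof. by move=> r0; rewrite LrE// -mulmxA dot_mulmx. Qed.

Lemma Lr_eq0 l r v : (forall e, 0 < l 0 e) -> (forall e, 0 <= r 0 e) ->
  (El o l n)^T *m v = 0 -> Lr o r n *m v = 0.
Proof.
move=> l0 r0 lv0; rewrite LrE// -mulmxA [(El o r n)^T *m v](_ : _ = 0) ?mulmx0//.
by apply/colP => k; rewrite (tr_El_rescale _ _ _ l0) lv0 !mxE mulr0.
Qed.

(** Passing from [l] to [r] multiplies each squared coordinate by [r e / l e], which is at least
    [a]. *)
Lemma dot_El_le_Lr l r (a : R) v : (forall e, 0 < l 0 e) ->
  (forall e, 0 <= r 0 e) -> (forall e, a * l 0 e <= r 0 e) ->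
  a * dot ((El o l n)^T *m v) ((El o l n)^T *m v) <= dot (Lr o r n *m v) v.
Proof.
move=> l0 r0 alr; rewrite dot_Lr// /dot mulr_sumr; apply: ler_sum => k _.
have key (s t c : R) : t = c * s -> a <= c ^+ 2 -> a * (s * s) <= t * t.
  by move=> -> ac; rewrite mulrACA -!expr2 ler_wpM2r ?sqr_ge0.
apply: key (tr_El_rescale r v k l0) _.
rewrite expr_div_n !sqr_sqrtr ?(ltW (l0 _))//.
by rewrite ler_pdivlMr.
Qed.

End IncidenceMatrices.

(** * Proximal steps *)

Section ProximalStep.
Context {R : realType} {p : nat} (X : set 'cV[R]_p).
Context (g psi : 'cV[R]_p -> R) (dpsi : 'cV[R]_p -> 'cV[R]_p).
Hypothesis convexX : convex_set X.
Hypothesis convexg : convex_function X g.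
Hypothesis dpsiP : directional X psi dpsi.

(** First-order optimality: compare [x] with [x + t (y - x)], bound [g] by convexity, expand [psi]
    to first order, divide by [t] and let [t] tend to 0. *)
Lemma argmin_variational (a : R) w x0 x y : 0 <= a ->
  is_argmin X (fun z => a * dot w z + a * g z + bregman psi dpsi z x0) x ->
  X y ->
  0 <= a * dot w (y - x) + a * (g y - g x) + dot (dpsi x - dpsi x0) (y - x).
Proof.
move=> a0 [Xx minx] Xy; apply/ler_addgt0Pl => e e0.
have [t [t0 t1 tdir]] : exists t : R, [/\ 0 < t, t <= 1 &
    `|psi (x + t *: (y - x)) - psi x - t * dot (dpsi x) (y - x)| <= e * t].
  have near_dir := dpsiP Xx Xy e0.
  near (0 : R)^'+ => t; exists t; split => //; last by near: t.
  by near: t; apply: nbhs_right_le.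
have t01 : 0 <= t <= 1 by rewrite ltW.
have := minx _ (convex_set_segment convexX Xx Xy t01).
have := ler_wpM2l a0 (convex_function_segment convexg Xx Xy t01).
move: tdir; rewrite ler_norml => /andP[_].
rewrite /bregman; move: (g _) (psi (_ + _)) => gt pt.
rewrite !(dotDl, dotDr, dotZl, dotZr, dotNl, dotNr) => l1 l2 l3.
rewrite -(pmulr_rge0 _ t0); lra.
Unshelve. all: end_near. Qed.

Hypothesis sc_psi : forall x y, X x -> X y ->
  2^-1 * dot (y - x) (y - x) <= bregman psi dpsi y x.

(** Each variational inequality is tested at the other minimizer. In the sum the values of [g]
    cancel, strong convexity bounds the [psi] part below by [|y1 - y2|^2], and Cauchy-Schwarz bounds
    what remains. *)
Lemma argmin_nonexpansive (a : R) w1 w2 x1 x2 y1 y2 : 0 <= a ->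
  is_argmin X (fun z => a * dot w1 z + a * g z + bregman psi dpsi z x1) y1 ->
  is_argmin X (fun z => a * dot w2 z + a * g z + bregman psi dpsi z x2) y2 ->
  norm2 (y1 - y2) <= norm2 (dpsi x1 - a *: w1 - (dpsi x2 - a *: w2)).
Proof.
move=> a0 m1 m2; have [[Xy1 _] [Xy2 _]] := (m1, m2).
have v1 := argmin_variational a0 m1 Xy2.
have v2 := argmin_variational a0 m2 Xy1.
have s12 := sc_psi Xy1 Xy2; have s21 := sc_psi Xy2 Xy1.
have [->|y12] := eqVneq (y1 - y2) 0; first by rewrite /norm2 dot0l sqrtr0 norm2_ge0.
have ny : 0 < norm2 (y1 - y2) by rewrite sqrtr_gt0 dot_gt0.
rewrite -(ler_pM2r ny) -expr2 norm2_sqr (le_trans _ (cauchy_schwarz _ _))//.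
move: s12 s21 v1 v2; rewrite /bregman.
rewrite !(dotDl, dotDr, dotZl, dotZr, dotNl, dotNr) (dotC y2 y1).
lra.
Qed.

End ProximalStep.

(** By induction on [K]: a new point [y] of weight [b] moves the mean along the segment towards [y]
    by the fraction [b / (A + b)]. Positivity and membership are carried along because the induction
    step uses them. *)
Lemma jensen_mean {R : realType} {p} (X : set 'cV[R]_p) h (a : nat -> R)
    (z : nat -> 'cV[R]_p) K (A := \sum_(1 <= k < K.+1) a k) :
  convex_set X -> convex_function X h ->
  (forall k, (1 <= k)%N -> 0 < a k) -> (forall k, (1 <= k)%N -> X (z k)) ->
  (1 <= K)%N ->
  [/\ 0 < A, X (A^-1 *: \sum_(1 <= k < K.+1) a k *: z k) &
    A * h (A^-1 *: \sum_(1 <= k < K.+1) a k *: z k) <=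
    \sum_(1 <= k < K.+1) a k * h (z k)].
Proof.
move=> cX ch a0 Xz; rewrite /A {A}; elim: K => // -[_ _|K /(_ isT)].
  have a1 := a0 1 isT; rewrite !big_nat1 scalerA mulVf ?scale1r ?(gt_eqF a1)//.
  by split => //; exact: Xz.
have recr (M : nmodType) (F : nat -> M) :
    \sum_(1 <= k < K.+3) F k = \sum_(1 <= k < K.+2) F k + F K.+2.
  by rewrite big_nat_recr.
rewrite !{}recr.
set A := \sum_(_ <= _ < _) _; set S := \sum_(_ <= _ < _) _.
set b := a K.+2; set y := z K.+2.
case=> A0 XS hS _; have b0 : 0 < b by exact: a0.
have Ab : 0 < A + b by rewrite addr_gt0.
have t01 : 0 <= b / (A + b) <= 1.
  by rewrite divr_ge0 ?(ltW b0) ?(ltW Ab)//= ler_pdivrMr// mul1r lerDr ltW.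
have Xy : X y by exact: Xz.
have -> : (A + b)^-1 *: (S + b *: y) =
    A^-1 *: S + (b / (A + b)) *: (y - A^-1 *: S).
  rewrite scalerBr scalerA addrCA scalerDr scalerA (mulrC _ b) addrC; congr (_ + _).
  rewrite -scalerBl; congr (_ *: _).
  by field; rewrite !gt_eqF.
split => //; first exact: convex_set_segment.
have := convex_function_segment ch XS Xy t01.
rewrite -(ler_pM2l Ab) => /le_trans; apply.
rewrite [leLHS](_ : _ = A * h (A^-1 *: S) + b * h y) ?lerD2r//.
by field; rewrite gt_eqF.
Qed.

(** * Convergence and semicontinuity along filters *)

Section ConvergenceAlongFilter.
Context {R : realType} {T : Type} (F : set_system T) {FF : Filter F}.

Lemma cvg_within {p} (V : topologicalType) (D : set 'cV[R]_p) (h : 'cV[R]_p -> V)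
    (Y : T -> 'cV[R]_p) (y : 'cV[R]_p) :
  {within D, continuous h} -> D y -> (forall t, D (Y t)) ->
  Y @ F --> y -> (fun t => h (Y t)) @ F --> h y.
Proof.
move=> /subspace_continuousP hc Dy DY Yy U /(hc _ Dy) hU.
have FU : F (Y @^-1` [set z | D z -> U (h z)]) by exact: Yy.
exact: (@filterS T F FF _ ((fun t => h (Y t)) @^-1` U) (fun t hY => hY (DY t)) FU).
Qed.

Lemma cvg_norm2_sub {p} (Y : T -> 'cV[R]_p) (y : 'cV[R]_p) :
  Y @ F --> y -> norm2 (Y t - y) @[t --> F] --> (0 : R).
Proof.
move=> Yy; have Yy0 : (fun t => Y t - y) @ F --> (0 : 'cV[R]_p).
  by rewrite -(subrr y); apply: cvgB => //; exact: cvg_cst.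
rewrite -(@sqrtr0 R) -(@dot0l R p 0).
exact: (@continuous_cvg _ _ _ _ FF _ Num.sqrt _ (@sqrt_continuous R _) (cvg_dot Yy0 Yy0)).
Qed.

Lemma norm2_sub_cvg {p} (Y : T -> 'cV[R]_p) (y : 'cV[R]_p) (b : T -> R) :
  (forall t, norm2 (Y t - y) <= b t) -> b @ F --> (0 : R) -> Y @ F --> y.
Proof.
move=> Yb b0; apply/cvg_coordP => i; apply/cvgrPdist_lt => e e0.
move/cvgrPdist_lt : b0 => /(_ _ e0); apply: filterS => t; rewrite sub0r normrN.
apply: le_lt_trans; rewrite distrC (le_trans _ (ler_norm _))//.
by apply: le_trans (Yb t); have := coord_le_norm2 (Y t - y) i; rewrite !mxE.
Qed.

Lemma cvg_block {N n} (Y : T -> 'cV[R]_(N * n)) (y : 'cV[R]_(N * n)) i :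
  Y @ F --> y -> block (Y t) i @[t --> F] --> block y i.
Proof.
move=> /cvg_coordP Yy; apply/cvg_coordP => j; rewrite mxE.
rewrite (eq_cvg _ _ (fun t => mxE _ _ j 0)); exact: Yy.
Qed.

(** This says that the lower limit of [h] along the filter is at least [a]. A filter on [T] replaces
    neighbourhoods so that the filters of noise codes below can be used. *)
Definition lsc_along (h : T -> R) (a : R) :=
  forall c, c < a -> \forall t \near F, c < h t.

Lemma cvg_lsc h a : h @ F --> a -> lsc_along h a.
Proof. by move=> ha c /(cvgr_gt a); apply. Qed.

Lemma le_lsc h1 h2 a : (forall t, h1 t <= h2 t) -> lsc_along h1 a -> lsc_along h2 a.
Proof. by move=> h12 ha c /ha; apply: filterS => t /lt_le_trans; apply. Qed.

Lemma lscD h1 h2 a b : lsc_along h1 a -> lsc_along h2 b ->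
  lsc_along (fun t => h1 t + h2 t) (a + b).
Proof.
move=> ha hb c cab; pose e := (a + b - c) / 2.
have e0 : 0 < e by rewrite divr_gt0// subr_gt0.
have /ha h1a : a - e < a by rewrite ltrBlDr ltrDl.
have /hb h2b : b - e < b by rewrite ltrBlDr ltrDl.
by move: h1a h2b; apply: filterS2 => t l1 l2; rewrite /e in l1 l2; lra.
Qed.

Lemma lsc_sum {I : Type} (r : seq I) (h : I -> T -> R) a :
  (forall i, lsc_along (h i) (a i)) ->
  lsc_along (fun t => \sum_(i <- r) h i t) (\sum_(i <- r) a i).
Proof.
move=> ha; elim: r => [|i r IH]; first by rewrite big_nil => c c0;
  under eq_near do rewrite big_nil; exact: nearW.
rewrite big_cons; under eq_fun do rewrite big_cons.
exact: lscD.
Qed.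

(** If [c < h y], the point [(y, c)] lies in the open complement of the epigraph, hence so does
    [(Y t, c)] eventually. *)
Lemma closed_on_lsc {p} (D : set 'cV[R]_p) h (Y : T -> 'cV[R]_p) (y : 'cV[R]_p) :
  closed_on D h -> (forall t, D (Y t)) -> Y @ F --> y ->
  lsc_along (fun t => h (Y t)) (h y).
Proof.
move=> cl DY Yy c cy.
have yU : (~` [set z : 'cV[R]_p * R | D z.1 /\ h z.1 <= z.2]) (y, c).
  by move=> /= [_]; rewrite leNgt cy.
have nU := open_nbhs_nbhs (conj (closed_openC cl) yU).
have FU := @cvg_pair T _ _ F (nbhs y) (nbhs c) FF (nbhs_filter y)
  (nbhs_filter c) Y (fun=> c) Yy (@cvg_cst _ c _ F FF) _ nU.
have sub t : ~ (D (Y t) /\ h (Y t) <= c) -> c < h (Y t).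
  by move=> /not_andP[//|/negP]; rewrite -ltNge.
exact: (@filterS T F FF _ (fun t => c < h (Y t)) sub FU).
Qed.

End ConvergenceAlongFilter.

Lemma within_continuous_sep_grad {R : realType} {N n} (X : set 'cV[R]_n)
    (dh : 'I_N -> 'cV[R]_n -> 'cV[R]_n) :
  (forall i, {within X, continuous (dh i)}) ->
  {within prod_set X, continuous (sep_grad dh)}.
Proof.
move=> dhc; apply/subspace_continuousP => x Xx.
have FF : Filter (within (prod_set X) (nbhs x)) by apply: within_filter.
apply/cvg_coordP => k.
rewrite mxE (eq_cvg _ _ (fun y => mxE _ _ k 0)).
set i := (mxtens_unindex k).1; set j := (mxtens_unindex k).2.
have : (fun y => dh i (block y i)) @ within (prod_set X) (nbhs x) --> dh i (block x i).
  move=> U; have /subspace_continuousP dci := dhc i.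
  move=> /(dci _ (Xx i)) dU.
  have bU := @cvg_block R _ (nbhs x) (nbhs_filter x) N n id x i cvg_id _ dU.
  exact: (@filterS _ (nbhs x) _ _ (fun y => prod_set X y -> U (dh i (block y i)))
    (fun y yU Xy => yU (Xy i)) bU).
by move=> dhx; exact: ((@cvg_coordP R n _ _ FF _ _).1 dhx j).
Qed.

(** * Functions depending continuously on independent noises *)

Section Coding.
Context {R : realType} {T : Type} {p : nat} (eta : nat -> T -> 'cV[R]_p) (k : nat).

(** An enumeration of the rationals with repetitions: numbers that decode to nothing are sent to
    0. *)
Definition rational_nth (c : nat) : R := ratr (odflt 0 (@choice.unpickle rat c)).

Lemma rational_nth_surj (q : rat) : exists c, rational_nth c = ratr q.
Proof. by exists (choice.pickle q); rewrite /rational_nth choice.pickleK. Qed.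

(* [code m t] records how the coordinates of [eta 1 t], ..., [eta k t] compare
   with the first [m] rationals: it takes finitely many values, and points with
   the same code for large [m] have close noises up to step [k]. *)
Definition code (m : nat) (t : T) : {ffun 'I_k * 'I_p * 'I_m -> bool} :=
  [ffun a : 'I_k * 'I_p * 'I_m => rational_nth a.2 <= eta a.1.1.+1 t a.1.2 0].

Lemma code_le m m' t t' : (m <= m')%N -> code m' t = code m' t' -> code m t = code m t'.
Proof.
move=> mm' /ffunP e; apply/ffunP => -[[j i] c].
by have := e (j, i, widen_ord mm' c); rewrite !ffunE.
Qed.

(** Neighbourhoods of [t] in the topology on [T] whose basic open sets are the code fibers. The
    first [k] noises converge along it, hence so does whatever is continuous in them. *)
Definition code_filter (t : T) : set_system T :=
  [set S | exists m, forall t', code m t' = code m t -> S t'].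

#[global] Instance code_filter_filter t : Filter (code_filter t).
Proof.
split.
- by exists 0%N.
- move=> A B [m mA] [m' mB]; exists (maxn m m') => t' e; split.
    by apply: mA; apply: code_le e; exact: leq_maxl.
  by apply: mB; apply: code_le e; exact: leq_maxr.
- by move=> A B AB [m mA]; exists m => t' /mA/AB.
Qed.

(** Two rationals enclose the coordinate within [e / 2] on either side. A code long enough to record
    both comparisons keeps the coordinate between them. *)
Lemma noise_cvg t j : (1 <= j <= k)%N -> eta j s @[s --> code_filter t] --> eta j t.
Proof.
case: j => [//|j /= jk].
apply/(@cvg_coordP R p _ _ (code_filter_filter t)) => i; apply/cvgrPdist_lt => e e0.
set r := eta j.+1 t i 0.
have /rat_in_itvoo[q1 /itvP q1P] : r - e / 2 < r by rewrite ltrBlDr ltrDl divr_gt0.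
have /rat_in_itvoo[q2 /itvP q2P] : r < r + e / 2 by rewrite ltrDl divr_gt0.
have [c1 c1E] := rational_nth_surj q1; have [c2 c2E] := rational_nth_surj q2.
exists (maxn c1 c2).+1 => t' /ffunP et.
have l1 : (c1 < (maxn c1 c2).+1)%N by rewrite ltnS leq_maxl.
have l2 : (c2 < (maxn c1 c2).+1)%N by rewrite ltnS leq_maxr.
have := et (Ordinal jk, i, Ordinal l1); have := et (Ordinal jk, i, Ordinal l2).
rewrite !ffunE/= c1E c2E -/r.
set r' := eta j.+1 t' i 0.
have -> : ratr q1 <= r by rewrite ltW// q1P.
have -> : ratr q2 <= r = false by apply/negbTE; rewrite -ltNge q2P.
move=> /negbT; rewrite -ltNge => r'q2 q1r'.
have rq1 : r - e / 2 < ratr q1 by rewrite q1P.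
have rq2 : ratr q2 < r + e / 2 by rewrite q2P.
by rewrite ltr_norml; lra.
Qed.

End Coding.

Section CodeMeasurability.
Context {R : realType} {d : measure_display} {T : measurableType d} {p : nat}.
Context (eta : nat -> T -> 'cV[R]_p) (k : nat).
Hypothesis etaRV : forall j, (1 <= j)%N -> random_vector (eta j).

(** A code fiber is an intersection of such conditions, one per noise, which is the form that
    independence handles. Ordinals start at 0 and noises at 1, hence the successor; for [j] outside
    [1..k] the box is the whole space. *)
Definition code_box m (b : {ffun 'I_k * 'I_p * 'I_m -> bool}) (j : nat) : set 'cV[R]_p :=
  \bigcap_(a in [set a : 'I_k * 'I_p * 'I_m | a.1.1.+1 == j])
    [set v | (rational_nth a.2 <= v a.1.2 0) = b a].

Lemma closed_coord (i : 'I_p) (A : set R) :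
  closed A -> closed [set v : 'cV[R]_p | A (v i 0)].
Proof.
apply: (@preimage_closed _ _ (fun v : 'cV[R]_p => v i 0)).
by move=> v _; exact: coord_continuous.
Qed.

Lemma borel_closed (A : set 'cV[R]_p) : closed A -> borel_set A.
Proof.
move=> cA; rewrite -(setCK A); apply: (@measurableC _ (g_sigma_algebraType open)).
by apply: sub_sigma_algebra; exact: closed_openC.
Qed.

Lemma borel_code_box m b j : borel_set (@code_box m b j).
Proof.
apply: (@fin_bigcap_measurable _ (g_sigma_algebraType open)) => // a _.
set A := [set v : 'cV[R]_p | rational_nth a.2 <= v a.1.2 0].
have bA : borel_set A.
  by apply: borel_closed; apply: (@closed_coord _ [set x | _ <= x]); exact: closed_ge.
have AE : [set v : 'cV[R]_p | (rational_nth a.2 <= v a.1.2 0) = b a] =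
    if b a then A else ~` A.
  by apply/seteqP; case: (b a); split => v; rewrite /A/=; case: (_ <= _).
suff bAb : borel_set (if b a then A else ~` A) by rewrite -AE in bAb; exact: bAb.
by case: (b a) => //; exact: (@measurableC _ (g_sigma_algebraType open)).
Qed.

Lemma code_fiberE m b : [set t | code eta k m t = b] =
  \bigcap_(j in [set j | (1 <= j <= k)%N]) (eta j @^-1` code_box b j).
Proof.
apply/seteqP; split => [t /= <- j jk a /= /eqP aj|t /= tb].
  by rewrite ffunE aj.
apply/ffunP => a; rewrite ffunE.
by apply: (tb a.1.1.+1 _ a) => //=.
Qed.

Lemma measurable_code_fiber m b : measurable [set t | code eta k m t = b].
Proof.
rewrite code_fiberE; apply: fin_bigcap_measurable => [|j /= /andP[j1 _]].
  apply: (@sub_finite_set _ _ `I_k.+1); last exact: finite_II.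
  by move=> j /= /andP[_]; rewrite ltnS.
by apply: etaRV => //; exact: borel_code_box.
Qed.

(** An open set is the union of the fibers it contains, and there are finitely many fibers for each
    of countably many [m]. *)
Lemma measurable_code_open (S : set T) :
  (forall t, S t -> code_filter eta k t S) -> measurable S.
Proof.
move=> openS.
rewrite (_ : S = \bigcup_m \bigcup_(b in [set b |
    [set t | code eta k m t = b] `<=` S]) [set t | code eta k m t = b]).
  apply: bigcupT_measurable => m; apply: fin_bigcup_measurable => // b _.
  exact: measurable_code_fiber.
apply/seteqP; split => [t St|t [m _ [b /= bS tb]]]; last exact: bS.
have [m mS] := openS t St; exists m => //; exists (code eta k m t) => //.
Qed.

(** Strict superlevel sets are open for the codes, and open rays generate the Borel sets. *)
Lemma lsc_measurable (h : T -> R) :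
  (forall t, lsc_along (code_filter eta k t) h (h t)) -> measurable_fun setT h.
Proof.
move=> lh mT; apply: (measurability _ (RGenOInfty.measurableE R)) => //.
move=> /= _ [_ [x ->] <-]; rewrite setTI; apply: measurable_code_open => t.
rewrite /= in_itv/= andbT => /lh; apply: filterS => t' /=.
by rewrite in_itv/= andbT.
Qed.

Lemma measurable_coord j i : (1 <= j)%N -> measurable_fun setT (fun t => eta j t i 0).
Proof.
move=> j1 mT; apply: (measurability _ (RGenOInfty.measurableE R)) => //.
move=> /= _ [_ [x ->] <-]; rewrite setTI.
rewrite (_ : _ @^-1` _ = eta j @^-1` ~` [set v | v i 0 <= x]).
  apply: etaRV => //; apply: (@measurableC _ (g_sigma_algebraType open)).
  by apply: borel_closed; apply: (@closed_coord _ [set y | y <= x]); exact: closed_le.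
by apply/seteqP; split => t /=; rewrite in_itv/= andbT ltNge => /negP.
Qed.

End CodeMeasurability.

(** * Independence and vanishing integrals *)

Lemma ge0_integral_mrestr {R : realType} {d} {T : measurableType d}
    (P : {measure set T -> \bar R}) (A : set T) (mA : measurable A) (f : T -> \bar R) :
  measurable_fun setT f -> (forall t, 0 <= f t)%E ->
  (\int[mrestr P mA]_t f t = \int[P]_(t in A) f t)%E.
Proof.
move=> mf f0; rewrite (@ge0_negligible_integral _ _ _ (mrestr P mA) setT (~` A))//.
- rewrite setTD setCK; apply: eq_measure_integral => B mB BA.
  by rewrite /= /mrestr (setIidl BA).
- exact: measurableC.
- by rewrite /= /mrestr setICl measure0.
Qed.

(** Independence says that the law of [X] under [P] restricted to [A] is [P A] times its law under
    [P]. So integrals of nonnegative functions of [X] scale by [P A]; this is applied to the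
    positive and negative parts. *)
Lemma indep_integral0 {R : realType} {d} {T : measurableType d}
    (P : probability T R) (A : set T) (X : T -> R) :
  measurable A -> measurable_fun setT X ->
  (forall C : set R, measurable C -> P (A `&` X @^-1` C) = P A * P (X @^-1` C))%E ->
  P.-integrable setT (EFin \o X) -> (\int[P]_t (X t)%:E = 0)%E ->
  (\int[P]_(t in A) (X t)%:E = 0)%E.
Proof.
move=> mA mX indep iX EX0.
have c0 : 0 <= fine (P A) by rewrite fine_ge0.
pose c : {nonneg R} := NngNum c0.
have cE : (c%:num%:E = P A)%E by rewrite /= fineK// fin_num_measure.
have ge0 (h : R -> \bar R) : measurable_fun setT h -> (forall r, 0 <= h r)%E ->
    (\int[P]_(t in A) h (X t) = P A * \int[P]_t h (X t))%E.
  move=> mh h0.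
  have mhX : measurable_fun setT (h \o X) by exact: measurableT_comp.
  rewrite -(ge0_integral_mrestr P mA mhX (fun t => h0 (X t))).
  rewrite -[LHS](ge0_integral_pushforward mX (mrestr P mA) (D := setT))//.
  rewrite -(ge0_integral_pushforward mX P (D := setT))// -cE.
  rewrite -ge0_integral_mscale//; apply: eq_measure_integral => C mC _.
  by rewrite /= /mscale/= /pushforward/= /mrestr setIC indep// cE.
have iA : P.-integrable A (EFin \o X) by exact: integrableS iX.
have mE : measurable_fun setT (@EFin R) by exact: EFin_measurable.
have posE : ((EFin \o X)^\+ = (fun t => (@EFin R)^\+ (X t)))%E.
  by apply/funext => t; rewrite !funeposE.
have negE : ((EFin \o X)^\- = (fun t => (@EFin R)^\- (X t)))%E.
  by apply/funext => t; rewrite !funenegE.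
have IP : (\int[P]_(t in A) (EFin \o X)^\+ t = P A * \int[P]_t (EFin \o X)^\+ t)%E.
  by rewrite posE; apply: ge0 => //; exact: measurable_funepos.
have IN : (\int[P]_(t in A) (EFin \o X)^\- t = P A * \int[P]_t (EFin \o X)^\- t)%E.
  by rewrite negE; apply: ge0 => //; exact: measurable_funeneg.
rewrite [LHS]integralE IP IN -muleBr ?fin_num_measure//; last exact: integrable_add_def iX.
by rewrite -integralE EX0 mule0.
Qed.

Lemma le_integrable_real {R : realType} {d} {T : measurableType d}
    (mu : {measure set T -> \bar R}) (h1 h2 : T -> R) : measurable_fun setT h1 ->
  (forall t, `|h1 t| <= h2 t) -> mu.-integrable setT (EFin \o h2) ->
  mu.-integrable setT (EFin \o h1).
Proof.
move=> mh h12; apply: le_integrable => //; first exact/measurable_EFinP.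
by move=> t _; rewrite /= lee_fin (le_trans (h12 t))// ler_norm.
Qed.

Section Independence.
Context {R : realType} {d : measure_display} {T : measurableType d}.
Context (P : probability T R) {p : nat} (eta : nat -> T -> 'cV[R]_p).
Hypothesis etaRV : forall j, (1 <= j)%N -> random_vector (eta j).
Hypothesis etaI : mutually_independent P [set k | (1 <= k)%N] eta.

Lemma independent_prefix (B : nat -> set 'cV[R]_p) K :
  (forall j, borel_set (B j)) ->
  P (\bigcap_(j in [set j | (1 <= j <= K)%N]) (eta j @^-1` B j)) =
  (\prod_(1 <= j < K.+1) P (eta j @^-1` B j))%E.
Proof.
move=> bB; pose J := [fset j in iota 1 K]%fset.
have JE j : (j \in J) = (1 <= j <= K)%N by rewrite in_fset mem_iota add1n ltnS.
have -> : [set j | (1 <= j <= K)%N] = [set` J].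
  by apply/seteqP; split => j /=; rewrite JE.
rewrite etaI => [||i _]; [|by move=> j /=; rewrite JE => /andP[]|exact: bB].
apply: perm_big; apply: uniq_perm => //; first exact: iota_uniq.
by move=> j; rewrite JE mem_iota subSS subn0 add1n ltnS.
Qed.

(** The fiber constrains only noises [1..k], so [C] can be appended as the condition on noise
    [k + 1]. Factoring the events for [k + 1] and for [k] noises gives the product. *)
Lemma independent_code_fiber k m (b : {ffun 'I_k * 'I_p * 'I_m -> bool}) C :
  borel_set C ->
  P ([set t | code eta k m t = b] `&` eta k.+1 @^-1` C) =
  (P [set t | code eta k m t = b] * P (eta k.+1 @^-1` C))%E.
Proof.
move=> bC; pose B j := if j == k.+1 then C else code_box b j.
have bB j : borel_set (B j) by rewrite /B; case: ifP => // _; exact: borel_code_box.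
have BE : [set t | code eta k m t = b] =
    \bigcap_(j in [set j | (1 <= j <= k)%N]) (eta j @^-1` B j).
  rewrite code_fiberE; apply: eq_bigcapr => j /= /andP[_ jk].
  by rewrite /B ltn_eqF.
rewrite (_ : _ `&` _ = \bigcap_(j in [set j | (1 <= j <= k.+1)%N]) (eta j @^-1` B j)).
  by rewrite independent_prefix// big_nat_recr//= -independent_prefix// -BE /B eqxx.
rewrite BE; apply/seteqP; split => [t [tB tC] j /= /andP[j1]|t tB].
  rewrite leq_eqVlt => /orP[/eqP ->|jk]; first by rewrite /B eqxx.
  by apply: tB; rewrite /= j1.
split=> [j /= /andP[j1 jk]|]; first by apply: tB; rewrite /= j1 ltnW.
by have := tB k.+1; rewrite /B eqxx; apply; rewrite /= ltnSn.
Qed.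

(* [Ym m] takes on each fiber of [code m] one of the values of [Y] there, chosen
   with almost minimal absolute value so that [`|Y| + 1] dominates all [Ym m]. *)
Lemma noise_orthogonal k i (Y : T -> R) :
  P.-integrable setT (fun t => (eta k.+1 t i 0)%:E) ->
  (\int[P]_t (eta k.+1 t i 0)%:E = 0)%E ->
  (forall t, Y s @[s --> code_filter eta k t] --> Y t) ->
  P.-integrable setT (fun t => (eta k.+1 t i 0 * Y t)%:E) ->
  (\int[P]_t (eta k.+1 t i 0 * Y t)%:E = 0)%E.
Proof.
set X := fun t => eta k.+1 t i 0.
move=> iX EX0 Yc iXY.
have mX : measurable_fun setT X by exact: measurable_coord.
have mY : measurable_fun setT Y 
  by apply: (lsc_measurable etaRV (k := k)) => t;
    exact: (@cvg_lsc R T _ (code_filter_filter eta k t) Y _ (Yc t)).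
pose good m b := [set r : R | exists t, [/\ code eta k m t = b, r = Y t &
  forall t', code eta k m t' = b -> `|r| <= `|Y t'| + 1]].
have good_ex m t : exists r, good m (code eta k m t) r.
  (* The infimum of [|Y|] on a fiber may not be attained, but the minimum of its integer part is, at
     the cost of at most 1. *)
  have [n [[t0 [et0 nE]] nmin]] : exists n, (exists t', code eta k m t' = code eta k m t /\
      Num.truncn `|Y t'| = n) /\ forall t', code eta k m t' = code eta k m t ->
      (n <= Num.truncn `|Y t'|)%N.
    have ex : exists n, `[< exists t', code eta k m t' = code eta k m t /\
      Num.truncn `|Y t'| = n >] by exists (Num.truncn `|Y t|); apply/asboolP; exists t.
    case: (ex_minnP ex) => n /asboolP nP nmin; exists n; split => // t' et'.
    by apply: nmin; apply/asboolP; exists t'.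
  exists (Y t0), t0; split => // t' /nmin nt'.
  have := truncnS_gt (`|Y t0|); rewrite nE => /ltW/le_trans; apply.
  rewrite -natr1 lerD2r (@le_trans _ _ (Num.truncn `|Y t'|)%:R) ?ler_nat//.
  by rewrite truncn_le.
pose y m b := xget 0 (good m b).
have yP m t : good m (code eta k m t) (y m (code eta k m t)).
  by have [r rP] := good_ex m t; exact: xgetI rP.
pose Ym m t := y m (code eta k m t).
have Ym_le m t : `|Ym m t| <= `|Y t| + 1.
  by have [t0 [_ _]] := yP m t; apply.
have Ym_cvg t : Ym m t @[m --> \oo] --> Y t.
  apply/cvgrPdist_lt => e e0.
  (* The neighbourhood contains a fiber of [code m0]; for [m >= m0] the point chosen in the finer
     fiber lies in it. *)
  move/cvgrPdist_lt : (Yc t) => /(_ e e0)[m0 m0P].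
  near=> m; have [t' [et' yE _]] := yP m t.
  rewrite /Ym yE; apply: m0P; apply: code_le et'; near: m; exact: nbhs_infty_ge.
pose fiber m (b : {ffun 'I_k * 'I_p * 'I_m -> bool}) := [set t | code eta k m t = b].
have mfib m b : measurable (@fiber m b) by exact: measurable_code_fiber.
(* [Ym m] is constant on fibers, so the product is a finite combination of restrictions of [X] to
   events independent of [X]. *)
have XYmE m : (fun t => (X t * Ym m t)%:E) =
    (fun t => \sum_b (y m b)%:E * ((EFin \o X) \_ (fiber m b)) t)%E.
  apply/funext => t; rewrite (bigD1 (code eta k m t))//= big1 => [|b bt].
    by rewrite patchE mem_set// adde0 -EFinM mulrC.
  by rewrite patchE memNset ?mule0// => /esym/eqP; apply/negP.
have ifib m b : P.-integrable setT ((EFin \o X) \_ (@fiber m b)).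
  apply/integrable_restrict => //; rewrite setTI.
  by apply: integrableS iX.
have EXYm m : (\int[P]_t (X t * Ym m t)%:E = 0)%E.
  rewrite XYmE integral_sum//; last by move=> b; exact: integrableZl.
  apply: big1 => b _; rewrite integralZl// -integral_mkcond.
  rewrite indep_integral0 ?mule0// => C mC.
  have bC : borel_set [set v : 'cV[R]_p | C (v i 0)].
    have mcoord : measurable_fun (setT : set (g_sigma_algebraType (@open 'cV[R]_p)))
        (fun v : 'cV[R]_p => v i 0).
      apply: (measurability _ (RGenOpens.measurableE R)) => //.
      move=> _ [_ [a [b' ->] <-]]; rewrite setTI; apply: sub_sigma_algebra.
      by apply: open_comp => [v _|]; [exact: coord_continuous|exact: itv_open].
    by have := mcoord measurableT C mC; rewrite setTI.
  exact: independent_code_fiber bC.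
have mYm m : measurable_fun setT (fun t => (X t * Ym m t)%:E).
  rewrite XYmE; apply: emeasurable_sum => b; apply: measurable_funeM.
  exact: measurable_int (ifib m b).
(* The dominating function [|X Y| + |X|] comes from [|Ym| <= |Y| + 1]. *)
have [||| _ _] := @dominated_convergence _ _ _ P setT measurableT
  (fun m t => (X t * Ym m t)%:E) (fun t => (X t * Y t)%:E)
  (fun t => `|(X t * Y t)%:E| + `|(X t)%:E|)%E mYm (measurable_int P iXY).
- apply/aeW => t _; apply: cvg_EFin; first exact: nearW.
  by apply: cvgMl_tmp; exact: Ym_cvg.
- by apply: integrableD => //; exact: integrable_abse.
- apply/aeW => t m _; rewrite !abse_EFin -EFinD lee_fin !normrM.
  by rewrite -[X in _ <= _ + X]mulr1 -mulrDr ler_wpM2l.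
have -> : [sequence (\int[P]_t (X t * Ym m t)%:E)%E]_m = fun=> 0%E.
  by apply/funext => m; exact: EXYm.
by move=> lim0; exact: (cvg_unique (@ereal_hausdorff R) lim0 (@cvg_cst _ _ _ _ _)).
Unshelve. all: end_near. Qed.

End Independence.

(** * The primal-dual iteration *)

Section PrimalDual.
Context {R : realType} {p q : nat} (X : set 'cV[R]_p).
Context (L : 'M[R]_p) (E : 'M[R]_(p, q)).
Context (f g psi : 'cV[R]_p -> R) (df dpsi : 'cV[R]_p -> 'cV[R]_p).
Context (beta lambda gamma : R) (xs : 'cV[R]_p) (us : 'cV[R]_q).
Hypothesis convexX : convex_set X.
Hypothesis convexg : convex_function X g.
Hypothesis dpsiP : directional X psi dpsi.
Hypothesis sc_psi : forall x y, X x -> X y ->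
  2^-1 * dot (y - x) (y - x) <= bregman psi dpsi y x.
Hypothesis convexf : forall x y, X x -> X y -> 0 <= bregman f df y x.
Hypothesis smoothf : forall x y, X x -> X y ->
  bregman f df y x <= beta / 2 * dot (y - x) (y - x).
Hypothesis symL : L^T = L.
Hypothesis L_ge : forall v,
  gamma^-1 * dot (E^T *m v) (E^T *m v) <= dot (L *m v) v.
Hypothesis L_psd : forall v, 0 <= dot (L *m v) v.
Hypothesis L_le : forall v, dot (L *m v) v <= lambda * dot v v.
Hypothesis Lxs : L *m xs = 0.
Hypothesis Exs : E^T *m xs = 0.
Hypothesis Xxs : X xs.
Hypothesis KKT :
  [set s + t | s in normal_cone X xs & t in subdiff X g xs] (- (E *m us) - df xs).

Let H x := lagrangian f E x us + g x.
Let V := energy psi dpsi xs us.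

(** Write the optimality condition as [s + t] and add three inequalities at [x]: normal cone for
    [s], subgradient for [t], convexity of [f]. *)
Lemma saddle_le x : X x -> H xs <= H x.
Proof.
move=> Xx; case: KKT => s Ns [t gt /(congr1 (fun z : 'cV[R]_p => dot z (x - xs)))].
have := convexf Xxs Xx; have := Ns _ Xx; have := gt _ Xx.
rewrite /H /lagrangian /bregman !(dotDl, dotDr, dotZl, dotZr, dotNl, dotNr).
lra.
Qed.

Lemma convex_H : convex_function X f -> convex_function X H.
Proof.
move=> cf; apply: convex_functionD => //; apply: convex_functionD => //.
exact: convex_function_dot.
Qed.

(** Strong convexity of [psi], with the dual term dropped. It lets the energy control the distance
    to [xs] in the integrability proofs. *)
Lemma energy_ge x u : X x -> 2^-1 * dot (x - xs) (x - xs) <= V x u.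
Proof.
move=> Xx; have := sc_psi Xx Xxs; rewrite /V /energy norm2_sqr.
have := dot_ge0 (u - us).
by rewrite -(opprB x xs) dotNl (dotNr (x - xs)) opprK; lra.
Qed.

Lemma energy_ge0 x u : X x -> 0 <= V x u.
Proof.
by move=> Xx; apply: le_trans (energy_ge u Xx); rewrite mulr_ge0 ?invr_ge0 ?dot_ge0.
Qed.

(** The dual update replaces [<E u, x'>] by [<E us, x'>] and leaves [a^2 / 2 |E^T x'|^2]. The bound
    [a <= 1 / gamma] trades this for [a / 2 <L x', x'>], to be combined with the primal term
    [- a <L x, x'>]. *)
Lemma energy_descent (a : R) x u e x' u' : 0 < a -> a <= gamma^-1 -> X x ->
  is_argmin X (fun y => a * dot (L *m x + E *m u + df x + e) y + a * g y
                        + bregman psi dpsi y x) x' ->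
  u' = u + a *: (E^T *m x') ->
  a * (H x' - H xs) <= V x u - V x' u'
    - (1 - a * (beta + lambda)) / 2 * dot (x' - x) (x' - x) - a * dot e (x' - xs).
Proof.
move=> a0 ag Xx amin ->; have Xx' : X x' by case: amin.
have vi := argmin_variational convexX convexg dpsiP (ltW a0) amin Xxs.
have three_point : dot (dpsi x' - dpsi x) (xs - x') =
    bregman psi dpsi xs x - bregman psi dpsi xs x' - bregman psi dpsi x' x.
  by rewrite /bregman !(dotDl, dotDr, dotZl, dotZr, dotNl, dotNr); ring.
have cf := ler_wpM2l (ltW a0) (convexf Xx Xxs).
have sf := ler_wpM2l (ltW a0) (smoothf Xx Xx').
have psc := sc_psi Xx Xx'.
have Lx := ler_wpM2l (ltW a0) (L_psd x).
have Ldiff := ler_wpM2l (ltW a0) (L_le (x' - x)).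
have Ele : a * dot (E^T *m x') (E^T *m x') <= dot (L *m x') x'.
  by apply: le_trans (L_ge _); rewrite ler_wpM2r ?dot_ge0.
have {}Ele := ler_wpM2l (ltW a0) Ele.
(* Polarization: [<L x', x'> / 2 - <L x, x'>] is half of [<L (x' - x), x' - x> - <L x, x>]. The
   first part is at most [lambda |x' - x|^2] and the second is dropped by positivity. *)
have LE : dot (L *m (x' - x)) (x' - x) =
    dot (L *m x) x + dot (L *m x') x' - 2 * dot (L *m x) x'.
  have Lsym : dot (L *m x') x = dot (L *m x) x' by rewrite dot_mulmx symL dotC.
  by rewrite mulmxBr !(dotDl, dotDr, dotNl, dotNr) Lsym; ring.
have Lxs0 : dot (L *m x) xs = 0 by rewrite dot_mulmx symL Lxs dot0r.
have Exs0 y : dot (E *m y) xs = 0 by rewrite dot_mulmx Exs dot0r.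
have uE : norm2 (u + a *: (E^T *m x') - us) ^+ 2 = dot (u - us) (u - us)
    + 2 * a * (dot (E *m u) x' - dot (E *m us) x') + a ^+ 2 * dot (E^T *m x') (E^T *m x').
  rewrite norm2_sqr !(dot_mulmx E); move: (E^T *m x') => v.
  rewrite !(dotDl, dotDr, dotZl, dotZr, dotNl, dotNr) !(dotC v) (dotC us u).
  by ring.
rewrite LE in Ldiff; rewrite {}three_point in vi.
rewrite /H /V /energy /lagrangian uE norm2_sqr (Exs0 us).
move: vi psc cf sf Ldiff; rewrite /bregman.
move: (dot (x' - x) (x' - x)) => D.
rewrite !(dotDl, dotDr, dotZl, dotZr, dotNl, dotNr) Lxs0 !Exs0.
lra.
Qed.

Section Iterates.
Hypothesis dfc : {within X, continuous df}.
Hypothesis dpsic : {within X, continuous dpsi}.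
Context {T : Type} (alpha : nat -> R) (eta : nat -> T -> 'cV[R]_p).
Context (x1 : 'cV[R]_p) (u1 : 'cV[R]_q).
Context (x : nat -> T -> 'cV[R]_p) (u : nat -> T -> 'cV[R]_q).
Hypothesis alpha_ge0 : forall k, (1 <= k)%N -> 0 <= alpha k.
Hypothesis Xx1 : X x1.
Hypothesis itP : forall t, iterates X L E df g psi dpsi alpha (eta ^~ t) x1 u1
  (x ^~ t) (u ^~ t).

Lemma iterates_in k t : (1 <= k)%N -> X (x k t).
Proof.
have [x1E _ it] := itP t; case: k => [//|[_|k _]]; first by rewrite x1E.
by have [[]] := it k.+1 isT.
Qed.

(** By induction, iterate [k] depends continuously on the noises strictly before [k]; the argmin
    step is handled by [argmin_nonexpansive]. *)
Lemma iterates_cvg (F : set_system T) {FF : Filter F} t0 k : (1 <= k)%N ->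
  (forall j, (1 <= j < k)%N -> eta j t @[t --> F] --> eta j t0) ->
  (x k t @[t --> F] --> x k t0) /\ (u k t @[t --> F] --> u k t0).
Proof.
elim: k => [//|[_ _ _|k IH _ etac]].
  have xE t : x 1 t = x1 by have [] := itP t.
  have uE t : u 1 t = u1 by have [] := itP t.
  by rewrite xE uE (eq_cvg _ _ xE) (eq_cvg _ _ uE); split; exact: cvg_cst.
have [//||xc uc] := IH.
  by move=> j /andP[j1 jk]; apply: etac; rewrite j1 ltnW.
pose w t := L *m x k.+1 t + E *m u k.+1 t + df (x k.+1 t) + eta k.+1 t.
have wc : w @ F --> w t0.
  apply: cvgD; last by apply: etac; rewrite /= ltnSn.
  apply: cvgD; first by apply: cvgD; apply: cvg_mulmx.
  by apply: (cvg_within dfc) => // [|t]; exact: iterates_in.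
(* The mirror point: its variation bounds that of the next primal iterate. *)
pose z t := dpsi (x k.+1 t) - alpha k.+1 *: w t.
have zc : z @ F --> z t0.
  apply: cvgB; last by apply: cvgZl_tmp.
  by apply: (cvg_within dpsic) => // [|t]; exact: iterates_in.
have xc' : x k.+2 t @[t --> F] --> x k.+2 t0.
  apply: (norm2_sub_cvg _ (cvg_norm2_sub zc)) => t.
  have [_ _ /(_ k.+1 isT)[m1 _]] := itP t.
  have [_ _ /(_ k.+1 isT)[m2 _]] := itP t0.
  exact: (argmin_nonexpansive convexX convexg dpsiP sc_psi (alpha_ge0 _) m1 m2).
split => //.
have uE t : u k.+2 t = u k.+1 t + alpha k.+1 *: (E^T *m x k.+2 t).
  by have [_ _ /(_ k.+1 isT)[]] := itP t.
rewrite uE (eq_cvg _ _ uE); apply: cvgD => //; apply: cvgZl_tmp.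
exact: cvg_mulmx.
Qed.

End Iterates.

(** * The bound for exact gradients *)

Section Noiseless.
Context (alpha : R) (x1 : 'cV[R]_p) (u1 : 'cV[R]_q).
Context (x : nat -> 'cV[R]_p) (u : nat -> 'cV[R]_q).
Hypothesis convexf_seg : convex_function X f.
Hypothesis alpha_gt0 : 0 < alpha.
Hypothesis alpha_gamma : alpha <= gamma^-1.
Hypothesis alpha_smooth : alpha * (beta + lambda) <= 1.
Hypothesis Xx1 : X x1.
Hypothesis itP : iterates X L E df g psi dpsi (fun=> alpha) (fun=> 0) x1 u1 x u.

Lemma noiseless_gap K : (1 <= K)%N ->
  H (K%:R^-1 *: \sum_(1 <= k < K.+1) x k.+1) - H xs <= V x1 u1 / (alpha * K%:R).
Proof.
move=> K1.
have Xx k : (1 <= k)%N -> X (x k).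
  (* Deterministic iterates are random ones over a one-point space. *)
  by apply: (@iterates_in unit (fun=> alpha) (fun _ _ => 0) x1 u1
    (fun k _ => x k) (fun k _ => u k) Xx1 (fun=> itP) k tt).
have desc k : (1 <= k)%N ->
    alpha * (H (x k.+1) - H xs) <= V (x k) (u k) - V (x k.+1) (u k.+1).
  move=> k1; have [_ _ /(_ k k1)[amin uE]] := itP.
  apply: le_trans (energy_descent alpha_gt0 alpha_gamma (Xx _ k1) amin uE) _.
  rewrite dot0l mulr0 subr0 gerBl mulr_ge0 ?dot_ge0// divr_ge0//.
  by rewrite subr_ge0.
have [KE XK HK] := @jensen_mean _ _ X H (fun=> 1) (fun k => x k.+1) K
  convexX (convex_H convexf_seg) (fun _ _ => ltr01) (fun k _ => Xx k.+1 isT) K1.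
move: HK; rewrite sumr_const_nat subSS subn0.
rewrite (eq_bigr (fun k => x k.+1)) => [|k _]; last by rewrite scale1r.
rewrite [leRHS](eq_bigr (fun k => H (x k.+1))) => [HK|k _]; last by rewrite mul1r.
have K0 : 0 < K%:R :> R by rewrite ltr0n.
rewrite ler_pdivlMr ?mulr_gt0// mulrC -mulrA.
apply: (@le_trans _ _ (\sum_(1 <= k < K.+1) alpha * (H (x k.+1) - H xs))).
  rewrite -mulr_sumr ler_pM2l// mulrBr sumrB lerB// sumr_const_nat subSS subn0.
  by rewrite mulr_natl.
apply: (@le_trans _ _ (\sum_(1 <= k < K.+1) (V (x k) (u k) - V (x k.+1) (u k.+1)))).
  rewrite big_nat_cond [leRHS]big_nat_cond; apply: ler_sum => k /andP[/andP[k1 _] _].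
  exact: desc.
have [<- <- _] := itP.
rewrite (eq_bigr (fun k => - (V (x k.+1) (u k.+1) - V (x k) (u k)))) => [|k _].
  rewrite sumrN telescope_sumr// opprB gerBl energy_ge0//.
  exact: Xx.
by rewrite opprB.
Qed.

End Noiseless.

(** * The bound in expectation for noisy gradients *)

Section Noisy.
Context {d : measure_display} {T : measurableType d} (P : probability T R).
Context (alpha : nat -> R) (sigma : R) (eta : nat -> T -> 'cV[R]_p).
Context (x1 : 'cV[R]_p) (u1 : 'cV[R]_q).
Context (x : nat -> T -> 'cV[R]_p) (u : nat -> T -> 'cV[R]_q).
Hypothesis convexf_seg : convex_function X f.
Hypothesis dfc : {within X, continuous df}.
Hypothesis dpsic : {within X, continuous dpsi}.
Hypothesis g_lsc : forall (F : set_system T) (FF : Filter F) (Y : T -> 'cV[R]_p) y,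
  (forall t, X (Y t)) -> Y @ F --> y -> lsc_along F (fun t => g (Y t)) (g y).
Hypothesis alpha_gt0 : forall k, (1 <= k)%N -> 0 < alpha k.
Hypothesis alpha_gamma : forall k, (1 <= k)%N -> alpha k <= gamma^-1.
Hypothesis alpha_smooth : forall k, (1 <= k)%N -> alpha k * (beta + lambda) <= 2^-1.
Hypothesis Xx1 : X x1.
Hypothesis itP : forall t, iterates X L E df g psi dpsi alpha (eta ^~ t) x1 u1
  (x ^~ t) (u ^~ t).
Hypothesis etaRV : forall k, (1 <= k)%N -> random_vector (eta k).
Hypothesis etaI : mutually_independent P [set k | (1 <= k)%N] eta.
Hypothesis eta_mean : forall k, (1 <= k)%N -> forall i,
  (\int[P]_t (eta k t i 0)%:E = 0)%E.
Hypothesis eta_var : forall k, (1 <= k)%N ->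
  (\int[P]_t (dot (eta k t) (eta k t))%:E <= (sigma ^+ 2)%:E)%E.

Let Xx k t : (1 <= k)%N -> X (x k t).
Proof. exact: iterates_in Xx1 itP k t. Qed.

(** The first [K] noises determine the first [K + 1] iterates, since the first iterate is fixed. *)
Let x_cvg k K t : (1 <= k <= K.+1)%N ->
  x k s @[s --> code_filter eta K t] --> x k t.
Proof.
move=> /andP[k1 kK]; have a0 j : (1 <= j)%N -> 0 <= alpha j by move=> /alpha_gt0/ltW.
apply: (iterates_cvg dfc dpsic a0 Xx1 itP _ _).1 => // j /andP[j1 jk].
by apply: noise_cvg; rewrite j1 -ltnS (leq_trans jk).
Qed.

Let x_coord_cvg k t i : (1 <= k)%N ->
  x k s i 0 @[s --> code_filter eta k.-1 t] --> x k t i 0.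
Proof.
move=> k1; have := @x_cvg k k.-1 t; rewrite prednK// k1 leqnn => /(_ isT).
by move=> /((@cvg_coordP R p _ _ (code_filter_filter eta _ t) _ _).1)/(_ i).
Qed.

Let measurable_x k i : (1 <= k)%N -> measurable_fun setT (fun t => x k t i 0).
Proof.
move=> k1; apply: (lsc_measurable etaRV (k := k.-1)) => t.
exact: (@cvg_lsc R T _ (code_filter_filter eta _ t) _ _ (@x_coord_cvg k t i k1)).
Qed.

Let measurable_dot (Y Z : T -> 'cV[R]_p) :
  (forall i, measurable_fun setT (fun t => Y t i 0)) ->
  (forall i, measurable_fun setT (fun t => Z t i 0)) ->
  measurable_fun setT (fun t => dot (Y t) (Z t)).
Proof. by move=> mY mZ; apply: measurable_sum => i; apply: measurable_funM. Qed.

Let measurable_xB k i : (1 <= k)%N -> measurable_fun setT (fun t => (x k t - xs) i 0).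
Proof.
move=> k1; rewrite (_ : (fun t => _) = (fun t => x k t i 0 - xs i 0)).
  by apply: measurable_funB => //; exact: measurable_x.
by apply/funext => t; rewrite !mxE.
Qed.

Let noise_sqr_integrable k : (1 <= k)%N ->
  P.-integrable setT (EFin \o (fun t => dot (eta k t) (eta k t))).
Proof.
move=> k1; apply/integrableP; split.
  by apply/measurable_EFinP; apply: measurable_dot => i; exact: measurable_coord.
under eq_integral do rewrite gee0_abs ?lee_fin ?dot_ge0//.
by apply: le_lt_trans (eta_var k1) _; rewrite ltry.
Qed.

Let noise_coord_integrable k i : (1 <= k)%N ->
  P.-integrable setT (EFin \o (fun t => eta k t i 0)).
Proof.
move=> k1; apply: (@le_integrable_real _ _ _ P _ (fun t => 1 + dot (eta k t) (eta k t))).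
- exact: measurable_coord.
- move=> t; apply: le_trans (lerD (lexx 1) (sqr_coord_le_dot _ i)).
  rewrite -real_normK ?num_real//; move: `|_| => r.
  rewrite -subr_ge0 (_ : _ - _ = (r - 2^-1) ^+ 2 + 3 / 4) ?addr_ge0 ?sqr_ge0//.
  by field.
- apply: (@eq_integrable _ _ _ _ setT measurableT
    (cst 1%E \+ (EFin \o (fun t => dot (eta k t) (eta k t))))%E) => //.
  apply: integrableD => //; last exact: noise_sqr_integrable.
  by apply: finite_measure_integrable_cst.
Qed.

(** Since [alpha (beta + lambda) <= 1/2], the descent keeps at least [|x' - x|^2 / 4]. This is
    exactly what Young's inequality with parameter 1 spends on [- alpha <eta, x' - x>], besides
    [alpha^2 |eta|^2]. *)
Lemma noisy_descent k t : (1 <= k)%N ->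
  alpha k * (H (x k.+1 t) - H xs) <= V (x k t) (u k t) - V (x k.+1 t) (u k.+1 t)
    + (alpha k ^+ 2 * dot (eta k t) (eta k t)
       - alpha k * dot (eta k t) (x k t - xs)).
Proof.
move=> k1; have [_ _ /(_ k k1)[amin uE]] := itP t.
apply: le_trans (energy_descent (alpha_gt0 k1) (alpha_gamma k1) (Xx _ k1) amin uE) _.
have D0 := dot_ge0 (x k.+1 t - x k t).
have young := dot_young (- alpha k *: eta k t) (x k.+1 t - x k t) ltr01.
have sm := ler_wpM2r D0 (alpha_smooth k1).
move: young sm; rewrite !(dotZl, dotZr).
have -> : x k.+1 t - xs = (x k.+1 t - x k t) + (x k t - xs) by rewrite addrA subrK.
rewrite (dotDr (eta k t) (x k.+1 t - x k t)).
move: (dot (x k.+1 t - x k t) _) D0 => D D0.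
lra.
Qed.

(** Induction on [k]. The gap is nonnegative by [saddle_le], so only the noise can raise the energy.
    Young's inequality with parameter 1/2 bounds [- <eta, x - xs>] by
    [|eta|^2 / 2 + |x - xs|^2 / 2], whose last term is at most the energy itself; hence the factor
    [1 + a]. *)
Let energy_dominated k : (1 <= k)%N -> exists2 W : T -> R,
  P.-integrable setT (EFin \o W) & forall t, V (x k t) (u k t) <= W t.
Proof.
elim: k => // -[_ _|k IH _].
  exists (fun=> V x1 u1); first exact: finite_measure_integrable_cst.
  by move=> t; have [-> -> _] := itP t.
have [//|W iW VW] := IH.
pose a := alpha k.+1; have a0 : 0 < a by exact: alpha_gt0.
exists (fun t => (1 + a) * W t + (a ^+ 2 + a / 2) * dot (eta k.+1 t) (eta k.+1 t)).
  apply: (@eq_integrable _ _ _ _ setT measurableT ((fun t => (1 + a)%:E * (W t)%:E) \+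
    (fun t => (a ^+ 2 + a / 2)%:E * (dot (eta k.+1 t) (eta k.+1 t))%:E))%E) => //.
  apply: integrableD => //; apply: integrableZl => //.
  exact: noise_sqr_integrable.
move=> t; have := noisy_descent t (isT : (1 <= k.+1)%N).
have Hge := saddle_le (Xx t (isT : (1 <= k.+2)%N)).
have := mulr_ge0 (ltW a0) (_ : 0 <= H (x k.+2 t) - H xs).
rewrite subr_ge0 => /(_ Hge) gap.
have Vge := energy_ge (u k.+1 t) (Xx t (isT : (1 <= k.+1)%N)).
have h0 : 0 < 2^-1 :> R by rewrite invr_gt0.
have young := dot_young (- eta k.+1 t) (x k.+1 t - xs) h0.
rewrite !(dotNl, dotNr) opprK in young.
have ayoung := ler_wpM2l (ltW a0) young.
have aVge := ler_wpM2l (ltW a0) Vge.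
have W1 : (1 + a) * V (x k.+1 t) (u k.+1 t) <= (1 + a) * W t.
  by rewrite ler_pM2l// addr_gt0.
rewrite -/a; move: gap ayoung aVge W1; rewrite -/a.
lra.
Qed.

Let x_sqr_integrable k : (1 <= k)%N ->
  P.-integrable setT (EFin \o (fun t => dot (x k t - xs) (x k t - xs))).
Proof.
move=> k1; have [W iW VW] := energy_dominated k1.
apply: (@le_integrable_real _ _ _ P _ (fun t => 2 * W t)).
- by apply: measurable_dot => i; exact: measurable_xB.
- move=> t; rewrite ger0_norm ?dot_ge0// -ler_pdivrMl//.
  by apply: le_trans (VW t); exact: energy_ge (Xx _ _).
- by apply: (@eq_integrable _ _ _ _ setT measurableT (fun t => 2%:E * (W t)%:E)%E) => //;
    exact: integrableZl.
Qed.

Let cross_coord_integrable k i : (1 <= k)%N ->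
  P.-integrable setT (EFin \o (fun t => eta k t i 0 * (x k t - xs) i 0)).
Proof.
move=> k1; apply: (@le_integrable_real _ _ _ P _ (fun t =>
    dot (eta k t) (eta k t) + dot (x k t - xs) (x k t - xs))).
- by apply: measurable_funM; [exact: measurable_coord|exact: measurable_xB].
- move=> t; apply: le_trans (lerD (sqr_coord_le_dot _ i) (sqr_coord_le_dot _ i)).
  rewrite normrM -[X in _ <= X + _]real_normK ?num_real//.
  rewrite -[X in _ <= _ + X]real_normK ?num_real//.
  have := normr_ge0 (eta k t i 0); have := normr_ge0 ((x k t - xs) i 0).
  move: `|_| `|_| => r s r0 s0.
  by have := sqr_ge0 (r - s); have := mulr_ge0 r0 s0; nra.
- apply: (@eq_integrable _ _ _ _ setT measurableT
    ((EFin \o (fun t => dot (eta k t) (eta k t))) \+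
     (EFin \o (fun t => dot (x k t - xs) (x k t - xs))))%E) => //.
  by apply: integrableD => //; [exact: noise_sqr_integrable|exact: x_sqr_integrable].
Qed.

Let cross_coord_mean k i : (1 <= k)%N ->
  (\int[P]_t (eta k t i 0 * (x k t - xs) i 0)%:E = 0)%E.
Proof.
case: k => // k k1; apply: noise_orthogonal => //.
- exact: noise_coord_integrable.
- exact: eta_mean.
- move=> t; rewrite (eq_cvg _ _ (fun s => mxE _ _ i 0)) !mxE.
  have FF := code_filter_filter eta k t.
  by apply: cvgD; [exact: (@x_coord_cvg k.+1 t i k1)|exact: cvg_cst].
- exact: cross_coord_integrable.
Qed.

Let noise_term k t := alpha k ^+ 2 * dot (eta k t) (eta k t)
  - alpha k * dot (eta k t) (x k t - xs).

Let noise_termE k : (EFin \o noise_term k) =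
  (fun t => (alpha k ^+ 2)%:E * (dot (eta k t) (eta k t))%:E +
   (- alpha k)%:E * (\sum_i (eta k t i 0 * (x k t - xs) i 0)%:E))%E.
Proof.
by apply/funext => t; rewrite sumEFin -!EFinM -EFinD /noise_term /= mulNr.
Qed.

Let cross_integrable k : (1 <= k)%N ->
  P.-integrable setT (fun t => \sum_i (eta k t i 0 * (x k t - xs) i 0)%:E)%E.
Proof. by move=> k1; apply: integrable_sum => // i _; exact: cross_coord_integrable. Qed.

Let noise_term_integrable k : (1 <= k)%N ->
  P.-integrable setT (EFin \o noise_term k).
Proof.
move=> k1; rewrite noise_termE; apply: integrableD => //; apply: integrableZl => //.
  exact: noise_sqr_integrable.
exact: cross_integrable.
Qed.

Let noise_term_mean k : (1 <= k)%N ->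
  (\int[P]_t (noise_term k t)%:E <= (sigma ^+ 2 * alpha k ^+ 2)%:E)%E.
Proof.
move=> k1.
rewrite -[X in (X <= _)%E]/(\int[P]_t ((EFin \o noise_term k) t))%E noise_termE.
rewrite integralD//; last 2 first.
- by apply: integrableZl => //; exact: noise_sqr_integrable.
- by apply: integrableZl => //; exact: cross_integrable.
rewrite integralZl//; last exact: noise_sqr_integrable.
rewrite integralZl//; last exact: cross_integrable.
rewrite integral_sum//; last by move=> i; exact: cross_coord_integrable.
rewrite [X in (_ + _ * X)%E]big1 ?mule0 ?adde0 => [|i _]; last exact: cross_coord_mean.
rewrite (mulrC (sigma ^+ 2)) (EFinM (alpha k ^+ 2)).
by apply: lee_wpmul2l; [rewrite lee_fin sqr_ge0|exact: eta_var].
Qed.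

(** Pathwise, [Z] lies between the constant [H xs] and an affine function of the integrable noise
    sum [S]. This gives integrability, and integrating the upper bound gives the estimate. *)
Lemma noisy_gap K (A := \sum_(1 <= k < K.+1) alpha k)
    (Z := fun t => H (A^-1 *: \sum_(1 <= k < K.+1) alpha k *: x k.+1 t)) :
  (1 <= K)%N ->
  P.-integrable setT (EFin \o Z) /\
  (\int[P]_t (Z t)%:E <=
   (H xs + (V x1 u1 + sigma ^+ 2 * \sum_(1 <= k < K.+1) alpha k ^+ 2) / A)%:E)%E.
Proof.
move=> K1.
have jensen t := @jensen_mean _ _ X H alpha (fun k => x k.+1 t) K
  convexX (convex_H convexf_seg) alpha_gt0 (fun k _ => Xx t (isT : (1 <= k.+1)%N)) K1.
(* [A] is deterministic, so its positivity may be read off at an arbitrary outcome. *)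
have A0 : 0 < A by have [] := jensen point.
pose S t := \sum_(1 <= k < K.+1) noise_term k t.
have Z_ge t : H xs <= Z t by have [_ /saddle_le] := jensen t.
have Z_le t : Z t <= H xs + (V x1 u1 + S t) / A.
  have [_ _] := jensen t; rewrite -/A -/(Z t) => AZ.
  rewrite -lerBlDl ler_pdivlMr// mulrC mulrBr.
  apply: (@le_trans _ _ (\sum_(1 <= k < K.+1) alpha k * (H (x k.+1 t) - H xs))).
    by under eq_bigr do rewrite mulrBr; rewrite sumrB -mulr_suml lerB.
  apply: (@le_trans _ _ (\sum_(1 <= k < K.+1)
      (V (x k t) (u k t) - V (x k.+1 t) (u k.+1 t) + noise_term k t))).
    rewrite big_nat_cond [leRHS]big_nat_cond; apply: ler_sum => k /andP[/andP[k1 _] _].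
    exact: noisy_descent.
  rewrite big_split lerD2r/=.
  rewrite (eq_bigr (fun k => - (V (x k.+1 t) (u k.+1 t) - V (x k t) (u k t)))).
    rewrite sumrN telescope_sumr// opprB.
    have [<- <- _] := itP t; rewrite gerBl energy_ge0//; exact: Xx.
  by move=> k _; rewrite opprB.
have iS : P.-integrable setT (EFin \o S).
  rewrite (_ : EFin \o S = (fun t => \sum_(k < K) (noise_term k.+1 t)%:E)%E).
    by apply: integrable_sum => // k _; exact: noise_term_integrable.
  by apply/funext => t; rewrite /= sumEFin /S big_add1 big_mkord.
have ES : (\int[P]_t (S t)%:E <=
    (sigma ^+ 2 * \sum_(1 <= k < K.+1) alpha k ^+ 2)%:E)%E.
  rewrite (eq_integral (fun t => \sum_(k < K) (noise_term k.+1 t)%:E)%E); last first.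
    by move=> t _; rewrite sumEFin /S big_add1 big_mkord.
  rewrite integral_sum//; last by move=> k; exact: noise_term_integrable.
  rewrite mulr_sumr big_add1 big_mkord -sumEFin; apply: lee_sum => k _.
  exact: noise_term_mean.
pose Y t := A^-1 *: \sum_(1 <= k < K.+1) alpha k *: x k.+1 t.
have XY t : X (Y t) by have [] := jensen t.
have Yc t : Y s @[s --> code_filter eta K t] --> Y t.
  have FF := code_filter_filter eta K t.
  apply: cvgZl_tmp; rewrite big_add1 big_mkord.
  rewrite (eq_cvg _ (g := fun s => \sum_(k < K) alpha k.+1 *: x k.+2 s)); last first.
    by move=> s; rewrite big_add1 big_mkord.
  apply: cvg_big => [|k _]; first exact: add_continuous.
  have kK : (1 <= k.+2 <= K.+1)%N by rewrite /= !ltnS.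
  by apply: cvgZl_tmp; exact: (@x_cvg k.+2 K t kK).
have mZ : measurable_fun setT Z.
  apply: (lsc_measurable etaRV (k := K)) => t.
  have FF := code_filter_filter eta K t.
  (* By convexity [f] lies above its tangent at [Y t], which is continuous in [s] and exact at
     [s = t]; with the semicontinuity of [g] this makes [Z] lower semicontinuous. *)
  apply: (@le_lsc R T _ FF (fun s => f (Y t) + dot (df (Y t)) (Y s - Y t)
      + dot (E *m us) (Y s) + g (Y s))).
    move=> s; rewrite lerD2r lerD2r -lerBrDl -subr_ge0.
    by have := convexf (XY t) (XY s); rewrite /bregman; lra.
  apply: lscD; last exact: g_lsc.
  have YYc : (fun s => Y s - Y t) @ code_filter eta K t --> (0 : 'cV[R]_p).
    by rewrite -(subrr (Y t)); apply: cvgB => //; exact: cvg_cst.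
  have c1 := @cvg_dot R p T _ FF _ _ _ _ (@cvg_cst _ (df (Y t)) _ _ FF) YYc; rewrite dot0r in c1.
  have c2 := @cvg_dot R p T _ FF _ _ _ _ (@cvg_cst _ (E *m us) _ _ FF) (Yc t).
  have c3 := cvgD (cvgD (@cvg_cst _ (f (Y t)) _ _ FF) c1) c2; rewrite addr0 in c3.
  exact: (@cvg_lsc R T _ FF (fun s => f (Y t) + dot (df (Y t)) (Y s - Y t)
    + dot (E *m us) (Y s)) _ (c3 FF FF)).
have V0 : 0 <= V x1 u1 by exact: energy_ge0.
have iZ : P.-integrable setT (EFin \o Z).
  (* The dominating function covers both the lower bound [H xs] and the upper bound by [S]. *)
  apply: (@le_integrable_real _ _ _ P _ (fun t => `|H xs| + V x1 u1 / A + A^-1 * `|S t|)) => //.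
    move=> t; have := Z_ge t; have := Z_le t; rewrite mulrDl (mulrC (S t)).
    have VA : 0 <= V x1 u1 / A by rewrite divr_ge0// ltW.
    have SA : A^-1 * S t <= A^-1 * `|S t| by rewrite ler_pM2l ?invr_gt0// ler_norm.
    have SA0 : 0 <= A^-1 * `|S t| by rewrite mulr_ge0// invr_ge0 ltW.
    have H1 := ler_norm (H xs); have H2 := ler_norm (- H xs); rewrite normrN in H2.
    by move=> ? ?; rewrite ler_norml; apply/andP; split; lra.
  apply: (@eq_integrable _ _ _ _ setT measurableT (cst (`|H xs| + V x1 u1 / A)%:E \+
    (fun t => A^-1%:E * (abse \o (EFin \o S)) t))%E) => //.
  apply: integrableD => //; first exact: finite_measure_integrable_cst.
  by apply: integrableZl => //; exact: integrable_abse.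
split => //.
have iA : P.-integrable setT (fun t => A^-1%:E * (S t)%:E)%E by exact: integrableZl.
have ic : P.-integrable setT (cst (H xs + V x1 u1 / A)%:E).
  exact: finite_measure_integrable_cst.
apply: (@le_trans _ _ (\int[P]_t ((H xs + V x1 u1 / A)%:E + A^-1%:E * (S t)%:E))%E).
  apply: le_integral => // [|t _]; first exact: integrableD.
  rewrite -EFinM -EFinD lee_fin; apply: le_trans (Z_le t) _.
  by rewrite mulrDl addrA (mulrC (S t)).
rewrite integralD// integral_cst//.
rewrite [X in ((_ * X)%E + _ <= _)%E](_ : _ = 1%E); last exact: probability_setT.
rewrite mule1 integralZl//.
rewrite [X in (_ <= (_ + X)%:E)%E]mulrDl addrA.
rewrite (EFinD (H xs + V x1 u1 / A)) (mulrC (sigma ^+ 2 * _)) (EFinM A^-1).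
apply: leeD => //.
by apply: lee_wpmul2l; rewrite // lee_fin invr_ge0 ltW.
Qed.

End Noisy.

End PrimalDual.

(** * From the distributed problem to the abstract iteration *)

Lemma directional_opp {R : realType} {p} (D : set 'cV[R]_p) h dh :
  directional D h dh -> directional D (fun x => - h x) (fun x => - dh x).
Proof.
move=> hd x y e Dx Dy e0; apply: filterS (hd x y e Dx Dy e0) => t.
by rewrite -normrN dotNl mulrN !opprD !opprK.
Qed.

(** Smoothness is the tangent inequality for [- h] with modulus [- c]. *)
Lemma sep_sum_bregman_le {R : realType} {N n} (X : set 'cV[R]_n)
    (h : 'I_N -> 'cV[R]_n -> R) dh (c : R) x y :
  convex_set X -> (forall i, directional X (h i) (dh i)) ->
  (forall i, convex_function X (fun z => c * norm2 z ^+ 2 - h i z)) ->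
  prod_set X x -> prod_set X y ->
  bregman (sep_sum h) (sep_grad dh) y x <= c * dot (y - x) (y - x).
Proof.
move=> cX hd hc Dx Dy.
have := @sep_sum_tangent _ _ _ X (fun i z => - h i z) (fun i z => - dh i z) (- c) x y
  cX (fun i => directional_opp (hd i)) _ Dx Dy.
rewrite !bregman_sep_sum => tangent.
rewrite -lerN2 -mulNr; apply: le_trans (tangent _) _.
  move=> i; rewrite (_ : (fun z => _) = (fun z => c * norm2 z ^+ 2 - h i z))//.
  by apply/funext => z; rewrite mulNr opprK addrC.
rewrite -sumrN; apply: ler_sum => i _.
by rewrite /bregman dotNl !opprD !opprK.
Qed.

Lemma sep_sum_lsc {R : realType} {N n} (X : set 'cV[R]_n) (h : 'I_N -> 'cV[R]_n -> R)
    {T : Type} (F : set_system T) (FF : Filter F) (Y : T -> 'cV[R]_(N * n)) y :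
  (forall i, closed_on X (h i)) -> (forall t, prod_set X (Y t)) -> Y @ F --> y ->
  lsc_along F (fun t => sep_sum h (Y t)) (sep_sum h y).
Proof.
move=> cl XY Yy; apply: lsc_sum => i.
exact: (@closed_on_lsc R T F FF n X (h i) (fun t => block (Y t) i) _ (cl i)
  (fun t => XY t i) (@cvg_block R T F FF N n Y y i Yy)).
Qed.

Theorem theorem3 (R : realType) (N n : nat) (G : graph N) (o : orientation G)
    (l r : 'rV[R]_(nb_edges G)) (gamma lambda beta : R)
    (X0 : set 'cV[R]_n)
    (psi0 : 'cV[R]_n -> R) (dpsi0 : 'cV[R]_n -> 'cV[R]_n)
    (fi : 'I_N -> 'cV[R]_n -> R) (dfi : 'I_N -> 'cV[R]_n -> 'cV[R]_n)
    (gi : 'I_N -> 'cV[R]_n -> R)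
    (xs x1 : 'cV[R]_(N * n)) (us u1 : 'cV[R]_(nb_edges G * n)) :
  let E : 'M[R]_(N * n, nb_edges G * n) := El o l n in
  let L : 'M[R]_(N * n) := Lr o r n in
  let X : set 'cV[R]_(N * n) := prod_set X0 in
  let f : 'cV[R]_(N * n) -> R := sep_sum fi in
  let df : 'cV[R]_(N * n) -> 'cV[R]_(N * n) := sep_grad dfi in
  let g : 'cV[R]_(N * n) -> R := sep_sum gi in
  let psi : 'cV[R]_(N * n) -> R := sep_sum (fun=> psi0) in
  let dpsi : 'cV[R]_(N * n) -> 'cV[R]_(N * n) := sep_grad (fun=> dpsi0) in
  let ell := lagrangian f E in
  let V := energy psi dpsi xs us in
  (0 < nb_edges G)%N ->
  connected_graph G ->
  (forall e, 0 < l 0 e) ->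
  (forall e, 0 < r 0 e) ->
  is_max [set a : R | forall e, a * l 0 e <= r 0 e] gamma^-1 ->
  is_max [set a : R | eigenvalue L a] lambda ->
  closed X0 ->
  convex_set X0 ->
  proper_on X0 psi0 -> closed_on X0 psi0 -> C1_on X0 psi0 dpsi0 ->
  strongly_convex1_on X0 psi0 ->
  0 <= beta ->
  (forall i, [/\ C1_on X0 (fi i) (dfi i), convex_function X0 (fi i) &
                 smooth_on X0 beta (fi i)]) ->
  (forall i, [/\ closed_on X0 (gi i), convex_function X0 (gi i) &
                 proper_on X0 (gi i)]) ->
  E^T *m xs = 0 ->
  X xs ->
  [set p + q | p in normal_cone X xs & q in subdiff X g xs] (- (E *m us) - df xs) ->
  X x1 ->
  (* (i) *)
  (forall (alpha : R) (x : nat -> 'cV[R]_(N * n))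
      (u : nat -> 'cV[R]_(nb_edges G * n)) (K : nat),
    iterates X L E df g psi dpsi (fun=> alpha) (fun=> 0) x1 u1 x u ->
    0 < alpha ->
    alpha <= Num.min (beta + lambda)^-1 gamma^-1 ->
    (1 <= K)%N ->
    let xbar := K%:R^-1 *: \sum_(1 <= k < K.+1) x k.+1 in
    (ell xbar us + g xbar) - (ell xs us + g xs) <= V x1 u1 / (alpha * K%:R))
  /\
  (* (ii) *)
  (forall (d : measure_display) (T : measurableType d) (P : probability T R)
      (alpha : nat -> R) (sigma : R) (eta : nat -> T -> 'cV[R]_(N * n))
      (x : nat -> T -> 'cV[R]_(N * n))
      (u : nat -> T -> 'cV[R]_(nb_edges G * n)) (K : nat),
    (forall t, iterates X L E df g psi dpsi alpha (fun k => eta k t) x1 u1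
                 (fun k => x k t) (fun k => u k t)) ->
    (forall k, (1 <= k)%N ->
      0 < alpha k /\ alpha k <= Num.min (2 * (beta + lambda))^-1 gamma^-1) ->
    (forall k, (1 <= k)%N -> random_vector (eta k)) ->
    mutually_independent P [set k | (1 <= k)%N] eta ->
    (forall k, (1 <= k)%N ->
      forall i, ('E_P[fun t => eta k t i 0%R] = 0)%E) ->
    (forall k, (1 <= k)%N ->
      ('E_P[fun t => (norm2 (eta k t) ^+ 2)%R] <= (sigma ^+ 2)%:E)%E) ->
    (1 <= K)%N ->
    let A := \sum_(1 <= k < K.+1) alpha k in
    let xbar t := A^-1 *: \sum_(1 <= k < K.+1) alpha k *: x k.+1 t in
    let Z t := ell (xbar t) us + g (xbar t) in
    P.-integrable setT (EFin \o Z) /\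
    ('E_P[Z] - (ell xs us + g xs)%:E <=
      ((V x1 u1 + sigma ^+ 2 * \sum_(1 <= k < K.+1) alpha k ^+ 2) / A)%:E)%E).
Proof.
move=> E L X f df g psi dpsi ell V _ _ l0 r0 [gammaP _] [_ lambdaP] clX0 cX0.
move=> _ _ psiC1 psi_sc beta0 fiP giP Exs Xxs KKT Xx1.
have r0' e : 0 <= r 0 e by exact: ltW.
have cX : convex_set X by exact: convex_prod_set.
have cg : convex_function X g by apply: convex_sep_sum => i; have [] := giP i.
have cf : convex_function X f by apply: convex_sep_sum => i; have [] := fiP i.
have dpsiP : directional X psi dpsi.
  by apply: directional_sep_sum => i; exact: C1_directional.
have fi_dir i : directional X0 (fi i) (dfi i).
  by have [fC1 _ _] := fiP i; exact: C1_directional.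
have sc x y : X x -> X y -> 2^-1 * dot (y - x) (y - x) <= bregman psi dpsi y x.
  by apply: sep_sum_tangent => // i; exact: C1_directional.
have f_convex x y : X x -> X y -> 0 <= bregman f df y x.
  (* Plain convexity is the tangent inequality with modulus 0. *)
  move=> Xx Xy; rewrite -(mul0r (dot (y - x) (y - x))).
  apply: (sep_sum_tangent cX0) => // i; have [_ cfi _] := fiP i.
  rewrite (_ : (fun z => _) = fi i)//.
  by apply/funext => z; rewrite mul0r subr0.
have f_smooth x y : X x -> X y -> bregman f df y x <= beta / 2 * dot (y - x) (y - x).
  by apply: sep_sum_bregman_le => // i; have [] := fiP i.
have symL : L^T = L by exact: Lr_sym.
have L_ge v : gamma^-1 * dot (E^T *m v) (E^T *m v) <= dot (L *m v) v.
  exact: dot_El_le_Lr.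
have L_psd v : 0 <= dot (L *m v) v by rewrite dot_Lr// dot_ge0.
have L_le v : dot (L *m v) v <= lambda * dot v v by exact: rayleigh_le.
have Lxs : L *m xs = 0 by exact: Lr_eq0 Exs.
have dfc : {within X, continuous df}.
  by apply: within_continuous_sep_grad => i; have [[_]] := fiP i.
have dpsic : {within X, continuous dpsi}.
  by apply: within_continuous_sep_grad => i; have [_] := psiC1.
(* Here [c] is 1 in part (i) and 2 in part (ii). Positivity of [beta + lambda] follows from that of
   the step size, which its scaled inverse bounds from above. *)
have step_le (a c : R) : 0 < c -> 0 < a -> a <= Num.min (c * (beta + lambda))^-1 gamma^-1 ->
    a <= gamma^-1 /\ a * (beta + lambda) <= c^-1.
  move=> c0 a0; rewrite le_min => /andP[ab ->]; split=> //.
  have bl0 : 0 < c * (beta + lambda) by rewrite -invr_gt0 (lt_le_trans a0).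
  have bl : 0 < beta + lambda by move: bl0; rewrite pmulr_rgt0.
  by rewrite -ler_pdivlMr// -invfM.
split.
- move=> alpha x u K it a0 amin K1.
  have [|ag asm] := step_le alpha 1 ltr01 a0; first by rewrite mul1r.
  rewrite invr1 in asm.
  exact: (@noiseless_gap R _ _ X L E f g psi df dpsi beta lambda gamma xs us
    cX cg dpsiP sc f_convex f_smooth symL L_ge L_psd L_le Lxs Exs Xxs
    alpha x1 u1 x u cf a0 ag asm Xx1 it K K1).
- move=> d T P alpha sigma eta x u K it aP etaRV etaI eta0 eta2 K1 A xbar Z.
  have a2 k (k1 : (1 <= k)%N) := step_le (alpha k) 2 (ltr0n _ 2) (aP k k1).1 (aP k k1).2.
  have mean0 k : (1 <= k)%N -> forall i, (\int[P]_t (eta k t i 0)%:E = 0)%E.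
    by move=> k1 i; have := eta0 k k1 i; rewrite unlock.
  have var_le k : (1 <= k)%N ->
      (\int[P]_t (dot (eta k t) (eta k t))%:E <= (sigma ^+ 2)%:E)%E.
    move=> k1; have := eta2 k k1; rewrite unlock.
    by under eq_integral do rewrite norm2_sqr.
  have g_lsc (F : set_system T) (FF : Filter F) (Y : T -> 'cV[R]_(N * n)) y :
      (forall t, X (Y t)) -> Y @ F --> y -> lsc_along F (fun t => g (Y t)) (g y).
    by apply: sep_sum_lsc => i; have [] := giP i.
  have [iZ EZ] := @noisy_gap R _ _ X L E f g psi df dpsi beta lambda gamma xs us
    cX cg dpsiP sc f_convex f_smooth symL L_ge L_psd L_le Lxs Exs Xxs KKT d T P alpha
    sigma eta x1 u1 x u cf dfc dpsic g_lsc (fun k k1 => (aP k k1).1)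
    (fun k k1 => (a2 k k1).1) (fun k k1 => (a2 k k1).2) Xx1 it etaRV etaI
    mean0 var_le K K1.
  split; first exact: iZ.
  by rewrite unlock leeBlDr// -EFinD addrC; exact: EZ.
Qed.
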